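(* Suppose that: (i) the observed index set $\Omega\subseteq[n]$ is drawn by the Bernoulli model with probability $p$ (each index in $[n]$ is included independently with probability $p$); (ii) the rank-$r$ Hankel matrix $\mathcal{H}\mathbf{x}^\natural=\mathcal{G}\mathbf{z}^\natural$ is $\mu$-incoherent, i.e., $\|\mathbf{U}^\natural\|_{2,\infty}\le\sqrt{\mu c_s r/n}$ and $\|\mathbf{V}^\natural\|_{2,\infty}\le\sqrt{\mu c_s r/n}$, where $\mathbf{U}^\natural\mathbf{\Sigma}^\natural\mathbf{V}^{\natural *}$ is its compact SVD and $c_s=\max\{n/n_1,n/n_2\}$; (iii) the observed outliers are $\alpha p$-sparse, $\|\Pi_\Omega\mathbf{s}^\natural\|_0\le\alpha p n$. Assume $p\ge(\varepsilon_0^{-2}\kappa^3c_s\mu r^2\log n)/n$ and $\alpha\le1/(32c_s\mu r\kappa)$, where $\varepsilon_0\in(0,\frac{\sqrt{\kappa r}}{8c_0})$ with some constant $c_0$. Then with probability at least $1-2n^{-2}$, the initialization step of HSGD satisfies $$d_0\le 26\alpha c_s\kappa\mu r\sqrt{r}\sqrt{\sigma_r^\natural}+7c_0\varepsilon_0\sqrt{\sigma_r^\natural/\kappa}.$$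
   Context: Setting: $\mathcal{H}$ is the Hankel mapping $\mathbb{C}^n\to\mathbb{C}^{n_1\times n_2}$, $[\mathcal{H}\mathbf{x}]_{i,j}=x_{i+j-1}$, $n=n_1+n_2-1$; $[\mathcal{D}\mathbf{x}]_i=\sqrt{\varsigma_i}x_i$ with $\varsigma_i$ the number of entries on the $i$-th antidiagonal; $\mathcal{G}=\mathcal{H}\mathcal{D}^{-1}$. $\mathbf{f}=\mathbf{z}^\natural+\mathbf{s}^\natural$ ($\mathbf{z}^\natural=\mathcal{D}\mathbf{x}^\natural$ low-rank Hankel part, $\mathbf{s}^\natural$ reweighted outliers) and only $\Pi_\Omega\mathbf{f}$ is observed ($\Pi_\Omega$ zeroes entries outside $\Omega$). $\sigma_i^\natural$ are singular values of $\mathcal{H}\mathbf{x}^\natural$, $\kappa=\sigma_1^\natural/\sigma_r^\natural$. HSGD initialization: $\mathbf{s}^{(0)}=\mathcal{D}\Gamma_{\alpha p}(\mathcal{D}^{-1}\Pi_\Omega\mathbf{f})$ where $\Gamma_{\tilde\alpha}$ keeps the $\tilde\alpha n$ largest-magnitude entries; $\mathbf{U}^{(0)}\mathbf{\Sigma}^{(0)}\mathbf{V}^{(0)*}$ is the rank-$r$ truncated SVD of $p^{-1}\mathcal{G}(\Pi_\Omega\mathbf{f}-\mathbf{s}^{(0)})$; $\tilde{\mathbf{L}}^{(0)}=\mathbf{U}^{(0)}(\mathbf{\Sigma}^{(0)})^{1/2}$, $\tilde{\mathbf{R}}^{(0)}=\mathbf{V}^{(0)}(\mathbf{\Sigma}^{(0)})^{1/2}$;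 $\mathbf{L}^{(0)}=\Pi_{\mathcal{L}}\tilde{\mathbf{L}}^{(0)}$, $\mathbf{R}^{(0)}=\Pi_{\mathcal{R}}\tilde{\mathbf{R}}^{(0)}$ with $\mathcal{L}=\{\mathbf{L}:\|\mathbf{L}\|_{2,\infty}^2\le\frac{2\mu rc_s}{n}\|\tilde{\mathbf{L}}^{(0)}\|_2^2\}$, $\mathcal{R}=\{\mathbf{R}:\|\mathbf{R}\|_{2,\infty}^2\le\frac{2\mu rc_s}{n}\|\tilde{\mathbf{R}}^{(0)}\|_2^2\}$. $d_0=\min_{\mathbf{Q}}\sqrt{\|\mathbf{L}^{(0)}-\mathbf{L}^\natural\mathbf{Q}\|_F^2+\|\mathbf{R}^{(0)}-\mathbf{R}^\natural\mathbf{Q}\|_F^2}$ over $r\times r$ rotation matrices $\mathbf{Q}$, with $\mathbf{L}^\natural=\mathbf{U}^\natural\mathbf{\Sigma}^{\natural1/2}$, $\mathbf{R}^\natural=\mathbf{V}^\natural\mathbf{\Sigma}^{\natural1/2}$. *)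

(* Defs.v *)
From HB Require Import structures.
From mathcomp Require Import all_boot all_order all_algebra.
From mathcomp Require Import zify complex.
From mathcomp Require Import boolp classical_sets reals exp.
Set Implicit Arguments. Unset Strict Implicit. Unset Printing Implicit Defensive.
Import Order.TTheory GRing.Theory Num.Theory.
Local Open Scope ring_scope.
Local Open Scope complex_scope.

Section Defs.
Variable R : realType.
Local Notation C := (R[i]).

Definition cabs2 (z : C) : R := let: a +i* b := z in a ^+ 2 + b ^+ 2.
Definition cabs (z : C) : R := Num.sqrt (cabs2 z).
Definition cconj (z : C) : C := let: a +i* b := z in a -i* b.
Definition ctr m k (A : 'M[C]_(m, k)) : 'M[C]_(k, m) := (map_mx cconj A)^T.
Definition unitary_cols m k (A : 'M[C]_(m, k)) : Prop := ctr A *m A = 1%:M.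

Definition frob m k (A : 'M[C]_(m, k)) : R :=
  Num.sqrt (\sum_(i < m) \sum_(j < k) cabs2 (A i j)).
Definition rownorm m k (A : 'M[C]_(m, k)) (i : 'I_m) : R :=
  Num.sqrt (\sum_(j < k) cabs2 (A i j)).
Definition norm2inf m k (A : 'M[C]_(m, k)) : R :=
  \big[Num.max/0]_(i < m) rownorm A i.
Definition specnorm m k (A : 'M[C]_(m, k)) : R :=
  sup [set t | exists v : 'cV[C]_k, frob v = 1 /\ t = frob (A *m v)].

Lemma hidx_proof n1 n2 (i : 'I_n1) (j : 'I_n2) : (i + j < (n1 + n2).-1)%N.
Proof.
have hi := ltn_ord i; have hj := ltn_ord j. lia.
Qed.
Definition hidx n1 n2 (i : 'I_n1) (j : 'I_n2) : 'I_(n1 + n2).-1 :=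
  Ordinal (hidx_proof i j).

Definition hankel n1 n2 (x : 'I_(n1 + n2).-1 -> C) : 'M[C]_(n1, n2) :=
  \matrix_(i, j) x (hidx i j).

Definition vsig n1 n2 (i : 'I_(n1 + n2).-1) : nat :=
  #|[set ab : 'I_n1 * 'I_n2 | hidx ab.1 ab.2 == i]|.

Definition Dop n1 n2 (x : 'I_(n1 + n2).-1 -> C) : 'I_(n1 + n2).-1 -> C :=
  fun i => (Num.sqrt (@vsig n1 n2 i)%:R)%:C * x i.
Definition Dinv n1 n2 (x : 'I_(n1 + n2).-1 -> C) : 'I_(n1 + n2).-1 -> C :=
  fun i => x i / (Num.sqrt (@vsig n1 n2 i)%:R)%:C.
Definition Gop n1 n2 (z : 'I_(n1 + n2).-1 -> C) : 'M[C]_(n1, n2) :=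
  hankel (Dinv z).

Definition PiO n (O : {set 'I_n}) (f : 'I_n -> C) : 'I_n -> C :=
  fun i => if i \in O then f i else 0.

Definition l0 n (v : 'I_n -> C) : nat := #|[set i | v i != 0]|.

Definition is_Gamma n (k : nat) (v w : 'I_n -> C) : Prop :=
  exists S : {set 'I_n},
    #|S| = minn k n /\
    (forall i j, i \in S -> j \notin S -> cabs (v j) <= cabs (v i)) /\
    w = PiO S v.

Definition lead_sub m k a b (A : 'M[C]_(m, k)) : 'M[C]_(a, b) :=
  \matrix_(i, j) match insub (nat_of_ord i) : option 'I_m,
                       insub (nat_of_ord j) : option 'I_k with
                 | Some i', Some j' => A i' j'
                 | _, _ => 0 end.
Arguments lead_sub {m k a b}.

Definition is_trunc_svd m k r (M : 'M[C]_(m, k))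
    (U0 : 'M[C]_(m, r)) (S0 : 'M[C]_r) (V0 : 'M[C]_(k, r)) : Prop :=
  exists (U' : 'M[C]_m) (Sg : 'M[C]_(m, k)) (V' : 'M[C]_k),
    unitary_cols U' /\ unitary_cols V' /\
    (forall i j, nat_of_ord i != nat_of_ord j -> Sg i j = 0) /\
    (forall i j, nat_of_ord i = nat_of_ord j -> exists s : R, 0 <= s /\ Sg i j = s%:C) /\
    (forall i j i' j', nat_of_ord i = nat_of_ord j -> nat_of_ord i' = nat_of_ord j' ->
        (i <= i')%N -> cabs (Sg i' j') <= cabs (Sg i j)) /\
    M = U' *m Sg *m ctr V' /\
    U0 = lead_sub U' /\ V0 = lead_sub V' /\ S0 = lead_sub Sg.

(* entrywise sqrt of a (diagonal, nonnegative real) matrix *)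
Definition sqrt_diag r (S : 'M[C]_r) : 'M[C]_r :=
  \matrix_(i, j) (Num.sqrt (let: a +i* _ := S i j in a))%:C.

Definition is_proj m k (Sset : 'M[C]_(m, k) -> Prop) (A P : 'M[C]_(m, k)) : Prop :=
  Sset P /\ forall Q, Sset Q -> frob (P - A) <= frob (Q - A).

Definition dist0 m k r (L0 Ln : 'M[C]_(m, r)) (R0 Rn : 'M[C]_(k, r)) : R :=
  inf [set d | exists Q : 'M[C]_r, unitary_cols Q /\
          d = Num.sqrt (frob (L0 - Ln *m Q) ^+ 2 + frob (R0 - Rn *m Q) ^+ 2)].

Definition bern_prob n (p : R) (E : {set {set 'I_n}}) : R :=
  \sum_(O in E) p ^+ #|O| * (1 - p) ^+ (n - #|O|).

End Defs.

Arguments hankel {R} n1 n2 x.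
Arguments Dop {R} n1 n2 x.
Arguments Dinv {R} n1 n2 x.
Arguments Gop {R} n1 n2 z.
Arguments vsig n1 n2 i.

Definition rdiag (R : realType) r (d : nat -> R) : 'M[R[i]]_r :=
  \matrix_(i, j) if i == j then (d i)%:C else 0.

(* Main.v *)
Require Import Defs.
From HB Require Import structures.
From mathcomp Require Import all_boot all_order all_algebra.
From mathcomp Require Import cyclic separable cyclotomic.
From mathcomp Require Import complex.
From mathcomp Require Import boolp classical_sets reals sequences exp.
From mathcomp Require Import zify ring lra.
Import Order.TTheory GRing.Theory Num.Theory.
Import Normc.
Local Open Scope ring_scope.
Local Open Scope complex_scope.
Set Implicit Arguments.
Unset Strict Implicit.
Unset Printing Implicit Defensive.

(* Write [Z = H x] for the true matrix, [beta = mu c_s r / n] and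
   [M = p^-1 G (Pi_Omega f - s0)] for the matrix that is truncated.  The residual
   [M - Z] is the Hankel matrix of [xi x + p^-1 (t - w)], where
   [xi_k = 1_Omega(k) / p - 1], [t] are the observed outliers and [w] the thresholded
   entries.  A Hankel matrix is a corner of an anticirculant one, so its operator
   norm is at most the largest modulus of the discrete Fourier transform of its
   symbol.  For [xi x] each of the [n] frequencies is a sum of independent centred
   variables, and a scalar Bernstein bound with a union bound suffices: incoherence
   gives [|x_k| <= beta sigma_1], and [|x|_2^2 <= 2 beta sigma_1^2] because the first
   row and the last column contain all entries.  For [t - w], which has few nonzero
   entries, each at most [2 beta sigma_1], the l1 norm suffices.

   With [|M - Z| <= e], Weyl's inequality gives [|M_r - Z| <= 2 e] for the rank-[r]
   truncation, hence [|M_r - Z|_F^2 <= 8 r e^2].  A Procrustes argument for the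
   balanced factorizations bounds the squared distance of the factors, up to a common
   unitary, by [3 |M_r - Z|_F^2 / sigma_r], and the projections, being
   onto convex sets that contain the rotated true factors, do not increase it. *)

(** * Modulus, conjugation and real parts of complex scalars *)

Section Scalars.
Variable R : realType.
Local Notation C := R[i].
Implicit Types (z w : C) (a : R).

(** [cconj] is convertible to the library conjugation, whose morphism properties it takes over; the
    [rmorph] lemmas and [fmorph_primitive_root] then apply to it. *)
HB.instance Definition _ :=
  GRing.isAdditive.Build C C (@cconj R) (@conjc_is_additive R).
HB.instance Definition _ :=
  GRing.isMultiplicative.Build C C (@cconj R) (@conjc_is_multiplicative R).

Lemma cconjK : involutive (@cconj R).
Proof. exact: conjcK. Qed.

Lemma cconj_real a : cconj a%:C = a%:C.
Proof. exact: conjc_real. Qed.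

Lemma ReD z w : complex.Re (z + w) = complex.Re z + complex.Re w.
Proof. by case: z w => [a b] [c d]. Qed.

Lemma ReN z : complex.Re (- z) = - complex.Re z.
Proof. by case: z. Qed.

Lemma ImD z w : complex.Im (z + w) = complex.Im z + complex.Im w.
Proof. by case: z w => [a b] [c d]. Qed.

Lemma Re_sum (I : Type) (s : seq I) (P : pred I) (F : I -> C) :
  complex.Re (\sum_(i <- s | P i) F i) = \sum_(i <- s | P i) complex.Re (F i).
Proof. by elim/big_rec2: _ => // i y1 y2 _ <-; rewrite ReD. Qed.

Lemma Im_sum (I : Type) (s : seq I) (P : pred I) (F : I -> C) :
  complex.Im (\sum_(i <- s | P i) F i) = \sum_(i <- s | P i) complex.Im (F i).
Proof. by elim/big_rec2: _ => // i y1 y2 _ <-; rewrite ImD. Qed.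

Lemma ReZ a z : complex.Re (a%:C * z) = a * complex.Re z.
Proof. by case: z => b c /=; rewrite mul0r subr0. Qed.

Lemma ImZ a z : complex.Im (a%:C * z) = a * complex.Im z.
Proof. by case: z => b c /=; rewrite mul0r addr0. Qed.

Lemma Re_conj z : complex.Re (cconj z) = complex.Re z.
Proof. by case: z. Qed.

Lemma cabs2E z : cabs2 z = complex.Re z ^+ 2 + complex.Im z ^+ 2.
Proof. by case: z. Qed.

Lemma cabs2_ge0 z : 0 <= cabs2 z.
Proof. by rewrite cabs2E addr_ge0 ?sqr_ge0. Qed.

Lemma cconj_mul z : cconj z * z = (cabs2 z)%:C.
Proof. by case: z => a b; congr Complex => /=; ring. Qed.

Lemma cabs2M z w : cabs2 (z * w) = cabs2 z * cabs2 w.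
Proof. by case: z w => [a b] [c d] /=; ring. Qed.

Lemma cabs2_real a : cabs2 a%:C = a ^+ 2.
Proof. by rewrite /= expr0n addr0. Qed.

Lemma cabs2_conj z : cabs2 (cconj z) = cabs2 z.
Proof. by case: z => a b /=; rewrite sqrrN. Qed.

Lemma cabs2N z : cabs2 (- z) = cabs2 z.
Proof. by case: z => a b /=; rewrite !sqrrN. Qed.

Lemma cabs2_0 : cabs2 (0 : C) = 0.
Proof. by rewrite /= expr0n addr0. Qed.

Lemma cabs2_eq0 z : (cabs2 z == 0) = (z == 0).
Proof.
rewrite cabs2E paddr_eq0 ?sqr_ge0 // !sqrf_eq0; case: z => a b /=.
by rewrite eq_complex.
Qed.

Lemma cabsE z : cabs z = normc z.
Proof. by case: z. Qed.

Lemma cabs_ge0 z : 0 <= cabs z.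
Proof. exact: sqrtr_ge0. Qed.

Lemma cabs_sqr z : cabs z ^+ 2 = cabs2 z.
Proof. by rewrite sqr_sqrtr ?cabs2_ge0. Qed.

Lemma cabsM z w : cabs (z * w) = cabs z * cabs w.
Proof. by rewrite !cabsE normcM. Qed.

Lemma cabsN z : cabs (- z) = cabs z.
Proof. by rewrite /cabs cabs2N. Qed.

Lemma cabs_real a : cabs a%:C = `|a|.
Proof. by rewrite /cabs cabs2_real sqrtr_sqr. Qed.

Lemma cabs0 : cabs (0 : C) = 0.
Proof. by rewrite (cabs_real 0) normr0. Qed.

Lemma cabsD z w : cabs (z + w) <= cabs z + cabs w.
Proof. by rewrite !cabsE le_normcD. Qed.

Lemma cabs_sum (I : Type) (s : seq I) (P : pred I) (F : I -> C) :
  cabs (\sum_(i <- s | P i) F i) <= \sum_(i <- s | P i) cabs (F i).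
Proof.
elim/big_rec2: _ => [|i y1 y2 _ h]; first by rewrite cabs0.
by apply: le_trans (cabsD _ _) _; rewrite lerD2l.
Qed.

Lemma Re_le_cabs z : `|complex.Re z| <= cabs z.
Proof. by rewrite -sqrtr_sqr ler_wsqrtr // cabs2E lerDl sqr_ge0. Qed.

Lemma Im_le_cabs z : `|complex.Im z| <= cabs z.
Proof. by rewrite -sqrtr_sqr ler_wsqrtr // cabs2E lerDr sqr_ge0. Qed.

Lemma cabs_le_ReIm z : cabs z <= `|complex.Re z| + `|complex.Im z|.
Proof.
rewrite -[leRHS]ger0_norm ?addr_ge0 // -[leRHS]sqrtr_sqr ler_wsqrtr //.
rewrite cabs2E sqrrD !real_normK ?num_real // lerD2r.
by rewrite lerDl mulrn_wge0 // mulr_ge0.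
Qed.

End Scalars.

(** * Frobenius inner product and operator norm bounds *)

Section Frobenius.
Variable R : realType.
Local Notation C := R[i].

Lemma ctrM m n k (A : 'M[C]_(m, n)) (B : 'M[C]_(n, k)) :
  ctr (A *m B) = ctr B *m ctr A.
Proof. by rewrite /ctr map_mxM trmx_mul. Qed.

Lemma ctrK m n : cancel (@ctr R m n) (@ctr R n m).
Proof. by move=> A; apply/matrixP => i j; rewrite !mxE cconjK. Qed.

Lemma ctrD m n (A B : 'M[C]_(m, n)) : ctr (A + B) = ctr A + ctr B.
Proof. by rewrite /ctr map_mxD linearD. Qed.

Lemma ctrB m n (A B : 'M[C]_(m, n)) : ctr (A - B) = ctr A - ctr B.
Proof. by rewrite /ctr map_mxB linearB. Qed.

Lemma ctr1 n : ctr 1%:M = 1%:M :> 'M[C]_n.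
Proof. by rewrite /ctr map_scalar_mx rmorph1 trmx1. Qed.

Lemma ctr_col m1 m2 n (A : 'M[C]_(m1, n)) (B : 'M[C]_(m2, n)) :
  ctr (col_mx A B) = row_mx (ctr A) (ctr B).
Proof. by rewrite /ctr map_col_mx tr_col_mx. Qed.

Definition rtr n (A : 'M[C]_n) : R := complex.Re (\tr A).

Lemma rtrD n (A B : 'M[C]_n) : rtr (A + B) = rtr A + rtr B.
Proof. by rewrite /rtr linearD ReD. Qed.

Lemma rtrN n (A : 'M[C]_n) : rtr (- A) = - rtr A.
Proof. by rewrite /rtr linearN ReN. Qed.

Lemma rtrZ n (a : R) (A : 'M[C]_n) : rtr (a%:C *: A) = a * rtr A.
Proof. by rewrite /rtr linearZ ReZ. Qed.

Lemma rtrC m n (A : 'M[C]_(m, n)) (B : 'M[C]_(n, m)) :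
  rtr (A *m B) = rtr (B *m A).
Proof. by rewrite /rtr mxtrace_mulC. Qed.

Lemma rtr_ctr n (A : 'M[C]_n) : rtr (ctr A) = rtr A.
Proof.
rewrite /rtr /ctr mxtrace_tr /mxtrace !Re_sum.
by apply: eq_bigr => i _; rewrite mxE Re_conj.
Qed.

(** Squared Frobenius norm, which keeps most of the argument free of square roots; on a column it is
    the squared Euclidean length. *)
Definition fro2 m n (A : 'M[C]_(m, n)) : R := \sum_i \sum_j cabs2 (A i j).

Lemma fro2_ge0 m n (A : 'M[C]_(m, n)) : 0 <= fro2 A.
Proof. by apply: sumr_ge0 => i _; apply: sumr_ge0 => j _; apply: cabs2_ge0. Qed.

Lemma frob_ge0 m n (A : 'M[C]_(m, n)) : 0 <= frob A.
Proof. exact: sqrtr_ge0. Qed.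

Lemma frob_sqr m n (A : 'M[C]_(m, n)) : frob A ^+ 2 = fro2 A.
Proof. by rewrite sqr_sqrtr ?fro2_ge0. Qed.

Lemma fro2E m n (A : 'M[C]_(m, n)) : fro2 A = rtr (ctr A *m A).
Proof.
rewrite /rtr /mxtrace Re_sum /fro2 exchange_big; apply: eq_bigr => j _ /=.
rewrite mxE Re_sum; apply: eq_bigr => i _.
by rewrite !mxE cconj_mul.
Qed.

Lemma fro2_ctr m n (A : 'M[C]_(m, n)) : fro2 (ctr A) = fro2 A.
Proof.
rewrite /fro2 exchange_big; apply: eq_bigr => j _; apply: eq_bigr => i _.
by rewrite !mxE cabs2_conj.
Qed.

Lemma fro2E' m n (A : 'M[C]_(m, n)) : fro2 A = rtr (A *m ctr A).
Proof. by rewrite -fro2_ctr fro2E ctrK. Qed.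

Lemma fro2_eq0 m n (A : 'M[C]_(m, n)) : fro2 A = 0 -> A = 0.
Proof.
move=> A0; apply/matrixP => i j; rewrite mxE; apply/eqP; rewrite -cabs2_eq0.
have h i' : 0 <= \sum_j' cabs2 (A i' j').
  by apply: sumr_ge0 => j' _; apply: cabs2_ge0.
move/eqP: A0; rewrite psumr_eq0 // => /allP/(_ i (mem_index_enum _)) /=.
rewrite psumr_eq0 => [|j' _]; last exact: cabs2_ge0.
by move=> /allP/(_ j (mem_index_enum _)).
Qed.

Lemma fro2_iso m n k (U : 'M[C]_(m, n)) (A : 'M[C]_(n, k)) :
  unitary_cols U -> fro2 (U *m A) = fro2 A.
Proof.
by move=> hU; rewrite !fro2E ctrM mulmxA -[_ *m U]mulmxA hU mulmx1.
Qed.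

Lemma fro2_isor m n k (U : 'M[C]_(m, n)) (A : 'M[C]_(k, n)) :
  unitary_cols U -> fro2 (A *m ctr U) = fro2 A.
Proof. by move=> hU; rewrite -fro2_ctr ctrM ctrK fro2_iso // fro2_ctr. Qed.

Lemma fro2Z m n (a : R) (A : 'M[C]_(m, n)) : fro2 (a%:C *: A) = a ^+ 2 * fro2 A.
Proof.
rewrite /fro2 mulr_sumr; apply: eq_bigr => i _; rewrite mulr_sumr.
by apply: eq_bigr => j _; rewrite mxE cabs2M cabs2_real.
Qed.

Lemma fro2N m n (A : 'M[C]_(m, n)) : fro2 (- A) = fro2 A.
Proof.
by apply: eq_bigr => i _; apply: eq_bigr => j _; rewrite mxE cabs2N.
Qed.

Lemma fro2_col m1 m2 n (A : 'M[C]_(m1, n)) (B : 'M[C]_(m2, n)) :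
  fro2 (col_mx A B) = fro2 A + fro2 B.
Proof. by rewrite !fro2E ctr_col mul_row_col rtrD. Qed.

Lemma fro2_unitary m n (U : 'M[C]_(m, n)) : unitary_cols U -> fro2 U = n%:R.
Proof.
move=> hU; rewrite fro2E hU /rtr mxtrace1 /=.
by rewrite -(rmorph_nat (real_complex R)).
Qed.

Lemma unitary_colsM m n k (A : 'M[C]_(m, n)) (B : 'M[C]_(n, k)) :
  unitary_cols A -> unitary_cols B -> unitary_cols (A *m B).
Proof.
rewrite /unitary_cols => hA hB.
by rewrite ctrM mulmxA -[_ *m A]mulmxA hA mulmx1.
Qed.

Lemma unitary_colsC n (A : 'M[C]_n) : unitary_cols A -> A *m ctr A = 1%:M.
Proof. exact: mulmx1C. Qed.

(** Real part of the Frobenius inner product: matrices are treated as a real Euclidean space, enough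
    for Cauchy-Schwarz and for completing squares. *)
Definition rip m n (A B : 'M[C]_(m, n)) : R := rtr (ctr A *m B).

Lemma ripC m n (A B : 'M[C]_(m, n)) : rip A B = rip B A.
Proof. by rewrite /rip -rtr_ctr ctrM ctrK. Qed.

Lemma ripZr m n (a : R) (A B : 'M[C]_(m, n)) : rip A (a%:C *: B) = a * rip A B.
Proof. by rewrite /rip -scalemxAr rtrZ. Qed.

Lemma ripDr m n (A B D : 'M[C]_(m, n)) : rip A (B + D) = rip A B + rip A D.
Proof. by rewrite /rip mulmxDr rtrD. Qed.

Lemma ripNr m n (A B : 'M[C]_(m, n)) : rip A (- B) = - rip A B.
Proof. by rewrite /rip mulmxN rtrN. Qed.

Lemma fro2D m n (A B : 'M[C]_(m, n)) :
  fro2 (A + B) = fro2 A + 2 * rip A B + fro2 B.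
Proof.
rewrite !fro2E ctrD mulmxDl !mulmxDr !rtrD.
have := ripC A B; rewrite /rip => ->; ring.
Qed.

Lemma fro2B m n (A B : 'M[C]_(m, n)) :
  fro2 (A - B) = fro2 A - 2 * rip A B + fro2 B.
Proof. by rewrite fro2D fro2N ripNr; ring. Qed.

Lemma rip_le m n (A B : 'M[C]_(m, n)) : rip A B <= frob A * frob B.
Proof.
have [B0|Bn0] := eqVneq (fro2 B) 0.
  by rewrite (fro2_eq0 B0) /rip mulmx0 /rtr mxtrace0 mulr_ge0 ?frob_ge0.
have Bp : 0 < fro2 B by rewrite lt_neqAle eq_sym Bn0 fro2_ge0.
have [h|h] := ltP (rip A B) 0.
  by apply: le_trans (ltW h) _; rewrite mulr_ge0 ?frob_ge0.
rewrite -(@ler_pXn2r _ 2) ?nnegrE ?mulr_ge0 ?frob_ge0 // exprMn !frob_sqr.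
(* The squared length of |B|^2 A - <A,B> B is |B|^2 (|A|^2 |B|^2 - <A,B>^2). *)
have := fro2_ge0 ((fro2 B)%:C *: A - (rip A B)%:C *: B).
rewrite fro2B !fro2Z ripZr [rip (_ *: _) _]ripC ripZr [rip B A]ripC.
move: Bp; move: (rip A B) (fro2 A) (fro2 B) => x y z z0 h1.
have: 0 <= z * (y * z - x ^+ 2) by lra.
by rewrite pmulr_rge0 // subr_ge0.
Qed.

Lemma frobD m n (A B : 'M[C]_(m, n)) : frob (A + B) <= frob A + frob B.
Proof.
rewrite -(@ler_pXn2r _ 2) ?nnegrE ?addr_ge0 ?frob_ge0 //.
rewrite sqrrD !frob_sqr fro2D lerD2r lerD2l -[leRHS]mulr_natl ler_wpM2l //.
exact: rip_le.
Qed.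

Lemma frobZ m n (a : R) (A : 'M[C]_(m, n)) : frob (a%:C *: A) = `|a| * frob A.
Proof. by rewrite /frob -!/(fro2 _) fro2Z sqrtrM ?sqr_ge0 // sqrtr_sqr. Qed.

Lemma frobN m n (A : 'M[C]_(m, n)) : frob (- A) = frob A.
Proof. by rewrite /frob -!/(fro2 _) fro2N. Qed.

Lemma fro2_row m n (A : 'M[C]_(m, n)) : fro2 A = \sum_i fro2 (row i A).
Proof.
apply: eq_bigr => i _; rewrite /fro2 big_ord1.
by apply: eq_bigr => j _; rewrite mxE.
Qed.

Lemma fro2_cols m n (A : 'M[C]_(m, n)) : fro2 A = \sum_j fro2 (col j A).
Proof.
rewrite /fro2 exchange_big; apply: eq_bigr => j _; apply: eq_bigr => i _.
by rewrite big_ord1 mxE.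
Qed.

Lemma rownormE m n (A : 'M[C]_(m, n)) i : rownorm A i = frob (row i A).
Proof.
by rewrite /rownorm /frob big_ord1; congr Num.sqrt; apply: eq_bigr => j _; rewrite mxE.
Qed.

(** A relation instead of a supremum: bounds are used vector by vector, and no supremum has to be
    shown finite. *)
Definition opnorm_le m n (A : 'M[C]_(m, n)) (c : R) :=
  forall v : 'cV[C]_n, fro2 (A *m v) <= c ^+ 2 * fro2 v.

Lemma opnorm_le_mx m n k (A : 'M[C]_(m, n)) (c : R) (B : 'M[C]_(n, k)) :
  opnorm_le A c -> fro2 (A *m B) <= c ^+ 2 * fro2 B.
Proof.
move=> hA; rewrite fro2_cols (fro2_cols B) mulr_sumr; apply: ler_sum => j _.
by rewrite !colE -mulmxA.
Qed.

(** Writing w for [ctr A *m v], |w|^2 = <A w, v> <= c |w| |v|, and |w| can be divided out. *)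
Lemma opnorm_le_ctr m n (A : 'M[C]_(m, n)) (c : R) : opnorm_le A c -> opnorm_le (ctr A) c.
Proof.
move=> hA v; have [|hp] := leP (fro2 (ctr A *m v)) 0.
  by move=> /le_trans; apply; rewrite mulr_ge0 ?sqr_ge0 ?fro2_ge0.
have e : fro2 (ctr A *m v) = rip (A *m (ctr A *m v)) v.
  by rewrite fro2E /rip !ctrM ctrK !mulmxA.
have h : fro2 (ctr A *m v) ^+ 2 <= (c ^+ 2 * fro2 v) * fro2 (ctr A *m v).
  rewrite mulrAC {1}e.
  have h0 : 0 <= rip (A *m (ctr A *m v)) v by rewrite -e fro2_ge0.
  apply: le_trans (_ : (frob (A *m (ctr A *m v)) * frob v) ^+ 2 <= _).
    by rewrite ler_pXn2r ?nnegrE ?mulr_ge0 ?frob_ge0 // rip_le.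
  rewrite exprMn !frob_sqr ler_wpM2r ?fro2_ge0 //; exact: hA.
by move: h; rewrite expr2 ler_pM2r.
Qed.

Lemma opnorm_le_frob m n (A : 'M[C]_(m, n)) (c : R) (v : 'cV[C]_n) :
  0 <= c -> opnorm_le A c -> frob (A *m v) <= c * frob v.
Proof.
move=> c0 /(_ v) h; rewrite -(@ler_pXn2r _ 2) ?nnegrE ?mulr_ge0 ?frob_ge0 //.
by rewrite exprMn !frob_sqr.
Qed.

Lemma opnorm_le_of_frob m n (A : 'M[C]_(m, n)) (c : R) :
  (forall v : 'cV_n, frob (A *m v) <= c * frob v) -> opnorm_le A c.
Proof.
move=> h v; rewrite -!frob_sqr -exprMn.
by rewrite ler_pXn2r ?nnegrE ?frob_ge0 // (le_trans _ (h v)) ?frob_ge0.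
Qed.

Lemma opnorm_leD m n (A B : 'M[C]_(m, n)) (a b : R) : 0 <= a -> 0 <= b ->
  opnorm_le A a -> opnorm_le B b -> opnorm_le (A + B) (a + b).
Proof.
move=> a0 b0 hA hB; apply: opnorm_le_of_frob => v; rewrite mulmxDl mulrDl.
by apply: le_trans (frobD _ _) _; apply: lerD; apply: opnorm_le_frob.
Qed.

Lemma opnorm_leN m n (A : 'M[C]_(m, n)) (a : R) : opnorm_le A a -> opnorm_le (- A) a.
Proof. by move=> h v; rewrite mulNmx fro2N. Qed.

Lemma opnorm_le_frobenius m n (A : 'M[C]_(m, n)) : opnorm_le A (frob A).
Proof.
move=> v; rewrite frob_sqr fro2_row (fro2_row A) mulr_suml.
apply: ler_sum => i _; rewrite row_mul.
set a := row i A.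
have [|hp] := leP (fro2 (a *m v)) 0.
  by move=> /le_trans; apply; rewrite mulr_ge0 ?fro2_ge0.
have e : fro2 (a *m v) = rip (ctr a *m (a *m v)) v.
  by rewrite fro2E /rip !ctrM ctrK !mulmxA.
have h : fro2 (a *m v) ^+ 2 <= (fro2 a * fro2 v) * fro2 (a *m v).
  have h0 : 0 <= rip (ctr a *m (a *m v)) v by rewrite -e fro2_ge0.
  rewrite {1}e; apply: le_trans (_ : (frob (ctr a *m (a *m v)) * frob v) ^+ 2 <= _).
    by rewrite ler_pXn2r ?nnegrE ?mulr_ge0 ?frob_ge0 // rip_le.
  rewrite exprMn !frob_sqr mulrAC ler_wpM2r ?fro2_ge0 // le_eqVlt; apply/orP; left.
  rewrite -(fro2_ctr a); set z := a *m v; rewrite /fro2 mulr_suml; apply/eqP.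
  apply: eq_bigr => j _; by rewrite !big_ord1 mxE big_ord1 cabs2M.
by move: h; rewrite expr2 ler_pM2r.
Qed.

End Frobenius.

(** * Polar decomposition *)

Section Polar.
Variable R : realType.
Local Notation C := R[i].
Local Open Scope sesquilinear_scope.

Lemma ctr_conj m n (A : 'M[C]_(m, n)) : A^t* = ctr A.
Proof. by rewrite /ctr map_trmx. Qed.

(** Positive semidefiniteness as a Gram factorization: Hermitian symmetry is immediate, and traces
    against another Gram matrix become squared norms. *)
Definition psd n (A : 'M[C]_n) := exists G : 'M[C]_n, A = ctr G *m G.

Definition real_diag n (d : 'I_n -> R) : 'M[C]_n := diag_mx (\row_i (d i)%:C).

Lemma ctr_real_diag n (d : 'I_n -> R) : ctr (real_diag d) = real_diag d.
Proof.
apply/matrixP => i j; rewrite !mxE eq_sym.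
by case: eqP => [->|_]; rewrite ?mulr1n ?mulr0n ?rmorph0 ?cconj_real.
Qed.

Lemma real_diagM n (d e : 'I_n -> R) : real_diag d *m real_diag e = real_diag (fun i => d i * e i).
Proof.
rewrite /real_diag mulmx_diag; congr diag_mx.
by apply/rowP => i; rewrite !mxE rmorphM.
Qed.

Lemma eq_real_diag n (d e : 'I_n -> R) : d =1 e -> real_diag d = real_diag e.
Proof. by move=> h; congr diag_mx; apply/rowP => i; rewrite !mxE h. Qed.

Lemma real_diag1 n : real_diag (fun _ : 'I_n => 1) = 1%:M.
Proof. by apply/matrixP => i j; rewrite !mxE. Qed.

(** The spectral theorem for normal matrices only yields complex eigenvalues; here they are the
    squared column norms of [A *m ctr P], hence real and nonnegative. *)
Lemma gram_spectral n (A : 'M[C]_n) :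
  exists (P : 'M[C]_n) (d : 'I_n -> R), [/\ unitary_cols P, P *m ctr P = 1%:M,
    forall i, 0 <= d i & ctr A *m A = ctr P *m real_diag d *m P].
Proof.
set B := ctr A *m A.
have /orthomx_spectralP : B \is normalmx.
  by apply/normalmxP; rewrite ctr_conj /B ctrM ctrK.
set P := spectralmx B; set s := spectral_diag B => eB.
have /unitarymxP := spectral_unitarymx B; rewrite ctr_conj -/P => PP.
have P'P : ctr P *m P = 1%:M by apply: mulmx1C.
rewrite invmx_unitary ?spectral_unitarymx // ctr_conj in eB.
pose F := A *m ctr P.
have eF : ctr F *m F = diag_mx s.
  rewrite /F ctrM ctrK mulmxA -[P *m _ *m _]mulmxA -/B eB !mulmxA PP mul1mx.
  by rewrite -mulmxA PP mulmx1.
exists P, (fun i => \sum_k cabs2 (F k i)); split; [exact: P'P|exact: PP| |].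
  by move=> i; apply: sumr_ge0 => k _; apply: cabs2_ge0.
rewrite eB; congr (_ *m _ *m _); congr diag_mx; apply/rowP => i.
have /matrixP/(_ i i) := eF; rewrite !mxE eqxx mulr1n => <-.
rewrite (rmorph_sum (real_complex R)); apply: eq_bigr => k _.
by rewrite !mxE cconj_mul.
Qed.

(** [Q] is [A] times the inverse square root of [ctr A *m A], formed in the eigenbasis [P]. *)
Lemma polar_unit n (A : 'M[C]_n) : A \in unitmx ->
  exists2 Q : 'M[C]_n, unitary_cols Q & psd (ctr Q *m A).
Proof.
move=> uA; have [P [d [P'P PP d0 eA]]] := gram_spectral A.
have dp i : 0 < d i.
  rewrite lt_neqAle d0 andbT eq_sym; apply/eqP => di.
  have e0 : real_diag d *m delta_mx i (0 : 'I_1) = 0.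
    apply/matrixP => k l; rewrite mul_diag_mx !mxE.
    by case: eqP => [->|_]; rewrite ?di ?rmorph0 ?mul0r ?mulr0.
  have := fro2E (A *m (ctr P *m delta_mx i (0 : 'I_1))).
  rewrite !ctrM ctrK -!mulmxA (mulmxA (ctr A) A) eA -!mulmxA.
  rewrite 2![P *m (ctr P *m _)]mulmxA PP !mul1mx e0 !mulmx0 /rtr mxtrace0.
  move=> /fro2_eq0 /(congr1 (mulmx (invmx A))).
  rewrite mulKmx // mulmx0 => /(congr1 (mulmx P)).
  rewrite mulmxA PP mul1mx mulmx0 => /matrixP/(_ i 0)/eqP.
  by rewrite !mxE !eqxx oner_eq0.
(* [s] holds the singular values of [A] and [q] their square roots, so that [real_diag q *m P] is a
   Gram factor of [ctr Q *m A]. *)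
pose s i := Num.sqrt (d i); pose q i := Num.sqrt (s i).
have sp i : 0 < s i by rewrite sqrtr_gt0.
have s2 i : s i * s i = d i by rewrite -expr2 sqr_sqrtr.
have q2 i : q i * q i = s i by rewrite -expr2 sqr_sqrtr // ltW.
exists (A *m ctr P *m real_diag (fun i => (s i)^-1) *m P).
  rewrite /unitary_cols !ctrM ctrK ctr_real_diag !mulmxA.
  rewrite -[_ *m ctr A *m A]mulmxA eA !mulmxA.
  rewrite -[_ *m P *m ctr P]mulmxA PP mulmx1.
  rewrite -[_ *m P *m ctr P]mulmxA PP mulmx1.
  rewrite -[_ *m real_diag _ *m real_diag d]mulmxA real_diagM -[_ *m real_diag _ *m real_diag _]mulmxA real_diagM.
  rewrite (_ : real_diag _ = 1%:M) ?mulmx1 //.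
  rewrite -real_diag1; apply: eq_real_diag => i; rewrite -s2; field.
  by rewrite gt_eqF.
exists (real_diag q *m P); rewrite !ctrM ctrK !ctr_real_diag.
rewrite -!mulmxA eA !mulmxA -[_ *m P *m ctr P]mulmxA PP mulmx1.
rewrite -[_ *m real_diag _ *m real_diag d]mulmxA real_diagM -[_ *m real_diag _ *m real_diag q]mulmxA real_diagM.
congr (_ *m _ *m _); apply: eq_real_diag => i; rewrite q2 -s2; field.
by rewrite gt_eqF.
Qed.

Lemma normalize m n (v : 'M[C]_(m, n)) : v != 0 ->
  exists2 c : R, c != 0 & fro2 (c%:C *: v) = 1.
Proof.
move=> v0; have vp : 0 < fro2 v.
  rewrite lt_neqAle fro2_ge0 andbT eq_sym; apply: contra v0 => /eqP/fro2_eq0 ->.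
  by [].
exists (Num.sqrt (fro2 v))^-1; first by rewrite invr_eq0 gt_eqF ?sqrtr_gt0.
by rewrite fro2Z exprVn sqr_sqrtr ?fro2_ge0 // mulVf ?gt_eqF.
Qed.

Lemma fro2_cV n (v : 'cV[C]_n) : ctr v *m v = (fro2 v)%:C%:M.
Proof.
apply/matrixP => i j; rewrite !ord1 !mxE eqxx mulr1n.
rewrite /fro2 (rmorph_sum (real_complex R)); apply: eq_bigr => k _.
by rewrite big_ord1 !mxE cconj_mul.
Qed.

Lemma singular_kernel n (A : 'M[C]_n) : A \notin unitmx ->
  exists2 v : 'cV[C]_n, A *m v = 0 & ctr v *m v = 1%:M.
Proof.
move=> nA; have : kermx A^T != 0.
  by rewrite kermx_eq0 row_free_unit unitmx_tr.
case/rowV0Pn => w /sub_kermxP wA w0.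
have wT0 : w^T != 0 by rewrite -trmx0 (inj_eq trmx_inj).
have [c _ c1] := normalize wT0.
exists (c%:C *: w^T); last by rewrite fro2_cV c1.
by rewrite -scalemxAr -[A]trmxK -trmx_mul wA trmx0 scaler0.
Qed.

(* A singular [A] is reduced to a matrix of larger rank by adding [u v^*] with
   unit vectors [u], [v] such that [u^* A = 0] and [A v = 0]. *)
Lemma polar n (A : 'M[C]_n) :
  exists2 Q : 'M[C]_n, unitary_cols Q & psd (ctr Q *m A).
Proof.
have [k] := ubnP (n - \rank A)%N; elim: k A => // k IH A hk.
have [uA|nA] := boolP (A \in unitmx); first exact: polar_unit.
have [v Av v1] := singular_kernel nA.
have nA' : ctr A \notin unitmx.
  apply: contra nA => uA.
  have : invmx (ctr A) *m ctr A = 1%:M by rewrite mulVmx.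
  by move/(congr1 (@ctr R n n)); rewrite ctrM ctrK ctr1 => /mulmx1_unit [].
have [u A'u u1] := singular_kernel nA'.
have uA : ctr u *m A = 0.
  by rewrite -[A]ctrK -ctrM A'u /ctr map_mx0 trmx0.
pose A' := A + u *m ctr v.
have uA' : ctr u *m A' = ctr v by rewrite mulmxDr uA add0r mulmxA u1 mul1mx.
have A'v : A' *m v = u by rewrite mulmxDl Av add0r -mulmxA v1 mulmx1.
(* The row [ctr v] lies in the row space of [A'] but not in that of [A], because A v = 0 and v has
   unit length; hence the rank grows strictly. *)
have vA' : (ctr v <= A')%MS by rewrite -uA' submxMl.
have rk : (\rank A < \rank A')%N.
  suff : (A < A')%MS by rewrite ltmxErank => /andP[].
  rewrite /ltmx; apply/andP; split.
    rewrite -[A](addrK (u *m ctr v)) -/A' addmx_sub // (eqmx_opp (u *m ctr v)).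
    by rewrite (submx_trans (submxMl _ _)).
  apply/negP => h; have /submxP [w vw] := submx_trans vA' h.
  have := v1; rewrite vw -mulmxA Av mulmx0 => /matrixP/(_ 0 0)/eqP.
  by rewrite !mxE eq_sym oner_eq0.
have [|Q hQ [G eG]] := IH A'; first by have := rank_leq_row A'; lia.
pose P := ctr Q *m A'.
have eP : P = ctr G *m G by [].
have hP : ctr P = P by rewrite eP ctrM ctrK.
have Q'Q := unitary_colsC hQ.
(* Since [Q] is unitary, P^2 is the Gram matrix of [A']; it fixes v because [A'] maps v to u and
   [ctr A'] maps u back to v. *)
have P2v : P *m (P *m v) = v.
  rewrite -{1}hP /P ctrM ctrK -!mulmxA [Q *m _]mulmxA Q'Q mul1mx A'v.
  by rewrite -[LHS]ctrK ctrM ctrK uA' ctrK.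
(* The vector w = P v - v satisfies P w = - w, which positive semidefiniteness of P only allows for
   w = 0. *)
have Pv : P *m v = v.
  apply/eqP; rewrite -subr_eq0; apply/eqP.
  set w := _ - _.
  have w0 : ctr G *m (G *m w) + w = 0.
    by rewrite mulmxA -eP /w mulmxBr P2v addrC subrKA subrr.
  apply: fro2_eq0; apply/eqP; rewrite eq_le fro2_ge0 andbT.
  have : fro2 (G *m w) + fro2 w = 0.
    by rewrite !fro2E -rtrD ctrM -!mulmxA -mulmxDr w0 mulmx0 /rtr mxtrace0.
  have := fro2_ge0 (G *m w); lra.
have vP : ctr v *m P = ctr v by rewrite -[in LHS]hP -ctrM Pv.
have Qu : ctr Q *m u = v by rewrite -A'v mulmxA.
(* As P fixes v, the product [ctr Q *m A] = P - v [ctr v] equals P compressed on both sides by 1 - v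
   [ctr v]. *)
exists Q => //; exists (G *m (1%:M - v *m ctr v)).
rewrite ctrM ctrB ctr1 ctrM ctrK mulmxA -[_ *m ctr G *m G]mulmxA -eP.
have -> : ctr Q *m A = P - v *m ctr v.
  by rewrite /P mulmxDr mulmxA Qu addrK.
rewrite mulmxBl mul1mx -mulmxA vP mulmxBr mulmx1 mulmxBl mulmxA Pv.
by rewrite -[v *m _ *m (v *m _)]mulmxA (mulmxA (ctr v)) v1 mul1mx subrr subr0.
Qed.

End Polar.

(** * Balanced Procrustes problem *)

Section Procrustes.
Variable R : realType.
Local Notation C := R[i].

(* With [Q] from the polar decomposition of [X^* W], [H = W - X Q], [N = H^* H] and
   the Hermitian [K = H^* X Q], the right-hand side equals
   [2 |X Q H^*|^2 + tr N^2 + 2 tr K^2 + 4 tr (K N)].  Complete the square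
   [(N + 4/3 K)^2] and use that [K + (X Q)^* (X Q)] is positive semidefinite. *)
Lemma procrustes m r (X W : 'M[C]_(m, r)) (s : R) :
  (forall k (v : 'M[C]_(r, k)), s * fro2 v <= fro2 (X *m v)) ->
  exists2 Q : 'M[C]_r, unitary_cols Q &
    2 / 3 * s * fro2 (W - X *m Q) <= fro2 (W *m ctr W - X *m ctr X).
Proof.
move=> hX; have [Q hQ [G eG]] := polar (ctr X *m W).
exists Q => //; have QQ := unitary_colsC hQ.
have [X' eX'] : exists X', X' = X *m Q by exists (X *m Q).
rewrite -eX'; set H := W - X'.
have -> : X *m ctr X = X' *m ctr X'.
  by rewrite eX' ctrM !mulmxA -[X *m Q *m _]mulmxA QQ mulmx1.
have eW : W = X' + H by rewrite /H addrC subrK.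
pose a := X' *m ctr H; pose N := ctr H *m H; pose K := ctr H *m X'.
have eP : ctr W *m X' = ctr G *m G.
  by have := congr1 (@ctr R _ _) eG; rewrite !ctrM !ctrK -mulmxA -eX'.
have eK : K = ctr G *m G - ctr X' *m X' by rewrite -eP -mulmxBl -ctrB.
have hK : ctr X' *m H = K.
  by have := congr1 (@ctr R _ _) eK; rewrite ctrB !ctrM !ctrK -eK.
have cK : ctr K = K by rewrite -{2}hK /K ctrM ctrK.
have cN : ctr N = N by rewrite /N ctrM ctrK.
have -> : W *m ctr W - X' *m ctr X' = a + ctr a + H *m ctr H.
  rewrite {1 2}eW ctrD mulmxDl !mulmxDr /a ctrM ctrK.
  by rewrite addrC !addrA addNr add0r.
have e1 : rip a (ctr a) = rtr (K *m K).
  rewrite /rip /a ctrM ctrK -mulmxA (mulmxA (ctr X')) hK.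
  by rewrite rtrC -mulmxA hK.
have e2 : rip a (H *m ctr H) = rtr (K *m N).
  by rewrite /rip /a ctrM ctrK -mulmxA (mulmxA (ctr X')) hK rtrC -mulmxA.
have e3 : rip (ctr a) (H *m ctr H) = rtr (K *m N).
  rewrite /rip /a ctrK -mulmxA (mulmxA (ctr H) H) rtrC -mulmxA rtrC.
  by rewrite -/K -/N.
have e4 : fro2 (H *m ctr H) = rtr (N *m N).
  by rewrite /N fro2E ctrM ctrK -mulmxA rtrC -!mulmxA.
have e5 : rtr (K *m N) = fro2 (H *m ctr G) - fro2 a.
  rewrite eK mulmxBl rtrD rtrN; congr (_ - _).
    by rewrite fro2E ctrM ctrK /N -!mulmxA [LHS]rtrC -!mulmxA.
  by rewrite fro2E' /a ctrM ctrK /N -!mulmxA [LHS]rtrC -!mulmxA.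
have e6 : fro2 (N + (4 / 3)%:C *: K) =
    rtr (N *m N) + 8 / 3 * rtr (K *m N) + 16 / 9 * rtr (K *m K).
  rewrite fro2D fro2Z ripZr !fro2E /rip cN cK (rtrC N K).
  by move: (rtr (N *m N)) (rtr (K *m N)) (rtr (K *m K)) => u v w; field.
have e7 : fro2 K = rtr (K *m K) by rewrite fro2E cK.
have e8 : fro2 (a + ctr a + H *m ctr H) =
    2 * fro2 a + rtr (N *m N) + 2 * rtr (K *m K) + 4 * rtr (K *m N).
  rewrite !fro2D fro2_ctr e1 e4.
  have -> : rip (a + ctr a) (H *m ctr H) = rtr (K *m N) + rtr (K *m N).
    by rewrite ripC ripDr ripC e2 ripC e3.
  by move: (fro2 a) (rtr (N *m N)) (rtr (K *m N)) (rtr (K *m K)) => t u v w; ring.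
have e9 : s * fro2 H <= fro2 a.
  by rewrite /a eX' -mulmxA; apply: le_trans (hX _ _); rewrite fro2_iso ?fro2_ctr.
(* The completed square uses 8/3 of the 4 tr (K N). The remaining 4/3 tr (K N) is at least -4/3
   |a|^2 by [e5], which leaves 2/3 |a|^2 and explains the constant. *)
have := fro2_ge0 (N + (4 / 3)%:C *: K); have := fro2_ge0 K.
have := fro2_ge0 (H *m ctr G); move: e5 e9; rewrite e8 e6 e7.
clear; move: (fro2 a) (rtr (N *m N)) (rtr (K *m N)) (rtr (K *m K)) => t u v w.
move: (fro2 (H *m ctr G)) (fro2 H) => x y; lra.
Qed.

(** By balance all terms except the cross terms agree on the two sides. With A = [ctr L *m L'] and B
    = [ctr M *m M'], the right side exceeds the left by 2 |A - B|^2. *)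
Lemma balanced_gram m k r (L L' : 'M[C]_(m, r)) (M M' : 'M[C]_(k, r)) :
  ctr L *m L = ctr M *m M -> ctr L' *m L' = ctr M' *m M' ->
  fro2 (col_mx L M *m ctr (col_mx L M) - col_mx L' M' *m ctr (col_mx L' M'))
    <= 4 * fro2 (L *m ctr M - L' *m ctr M').
Proof.
move=> h h'.
have e p (A B : 'M[C]_(p, r)) : rip (A *m ctr A) (B *m ctr B) = fro2 (ctr A *m B).
  by rewrite /rip fro2E' !ctrM !ctrK -!mulmxA [LHS]rtrC -!mulmxA.
have e' p (A : 'M[C]_(p, r)) : fro2 (A *m ctr A) = fro2 (ctr A *m A).
  by rewrite -e /rip fro2E.
have e2 (A : 'M[C]_(m, r)) (B : 'M[C]_(k, r)) :
    ctr A *m A = ctr B *m B -> fro2 (A *m ctr B) = fro2 (ctr A *m A).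
  move=> hAB; rewrite !fro2E ctrM !ctrK -mulmxA (mulmxA (ctr A)) hAB.
  by rewrite [LHS]rtrC ctrM ctrK -!mulmxA.
rewrite !fro2B !e' e !ctr_col !mul_row_col -h -h' (e2 _ _ h) (e2 _ _ h').
have two p (A : 'M[C]_p) : fro2 (A + A) = 4 * fro2 A.
  rewrite fro2D /rip -fro2E; lra.
rewrite !two; set A := ctr L *m L'; set B := ctr M *m M'.
have -> : rip (L *m ctr M) (L' *m ctr M') = rip A B.
  transitivity (rtr (A *m ctr B)); last by rewrite -rtr_ctr ctrM ctrK rtrC.
  by rewrite /rip /A /B !ctrM !ctrK -!mulmxA [LHS]rtrC -!mulmxA.
have := fro2_ge0 (A - B); rewrite fro2B fro2D; lra.
Qed.

(** [procrustes] for the stacked factors: balance turns the lower bound into 2 s, and 2/3 of 2 s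
    against the 4 of [balanced_gram] gives the constant 3. *)
Lemma factor_dist m k r (L L' : 'M[C]_(m, r)) (M M' : 'M[C]_(k, r)) (s : R) :
  ctr L *m L = ctr M *m M -> ctr L' *m L' = ctr M' *m M' ->
  (forall j (v : 'M[C]_(r, j)), s * fro2 v <= fro2 (L' *m v)) ->
  exists2 Q : 'M[C]_r, unitary_cols Q &
    s * (fro2 (L - L' *m Q) + fro2 (M - M' *m Q))
      <= 3 * fro2 (L *m ctr M - L' *m ctr M').
Proof.
move=> h h' hs.
have [j v|Q hQ hd] := @procrustes _ _ (col_mx L' M') (col_mx L M) (2 * s).
  rewrite mul_col_mx fro2_col (_ : fro2 (M' *m v) = fro2 (L' *m v)).
    have := hs j v; lra.
  by rewrite !fro2E !ctrM -!mulmxA !(mulmxA (ctr _) _ v) h'.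
exists Q => //; have := le_trans hd (balanced_gram h h').
rewrite mul_col_mx opp_col_mx add_col_mx fro2_col; lra.
Qed.

End Procrustes.

(** * Truncated singular value decomposition *)

Section TruncatedSvd.
Variable R : realType.
Local Notation C := R[i].

Definition rect_diag m k (A : 'M[C]_(m, k)) :=
  forall i j, nat_of_ord i != nat_of_ord j -> A i j = 0.

Lemma rect_diag_fro2 m k (A : 'M[C]_(m, k)) (v : 'cV[C]_k) : rect_diag A ->
  fro2 (A *m v) = \sum_j (\sum_i cabs2 (A i j)) * cabs2 (v j 0).
Proof.
move=> hA; rewrite /fro2.
transitivity (\sum_i \sum_j cabs2 (A i j) * cabs2 (v j 0)); last first.
  by rewrite exchange_big; apply: eq_bigr => j _; rewrite mulr_suml.
apply: eq_bigr => i _; rewrite big_ord1 mxE.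
have [ik|ki] := ltnP i k; last first.
  have z j : A i j = 0 by apply: hA; have := ltn_ord j; lia.
  by rewrite !big1 ?cabs2_0 // => j _; rewrite z ?mul0r // cabs2_0 mul0r.
have z j : j != Ordinal ik -> A i j = 0.
  by move=> hj; apply: hA; apply: contra hj => /eqP e; apply/eqP/val_inj.
rewrite (bigD1 (Ordinal ik)) //= big1 ?addr0; last by move=> j /z ->; rewrite mul0r.
rewrite (bigD1 (Ordinal ik)) //= big1 ?addr0 ?cabs2M // => j /z ->.
by rewrite cabs2_0 mul0r.
Qed.

Lemma rect_diag_ub m k (A : 'M[C]_(m, k)) (c : R) : rect_diag A -> 
  (forall i j, nat_of_ord i = nat_of_ord j -> cabs2 (A i j) <= c ^+ 2) ->
  opnorm_le A c.
Proof.
move=> hA hc v; rewrite rect_diag_fro2 // /fro2 mulr_sumr; apply: ler_sum => j _.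
rewrite big_ord1; apply: ler_wpM2r; first exact: cabs2_ge0.
have z i : nat_of_ord i != nat_of_ord j -> cabs2 (A i j) = 0.
  by move=> /hA ->; rewrite cabs2_0.
have [jm|mj] := ltnP j m; last first.
  by rewrite big1 ?sqr_ge0 // => i _; apply: z; have := ltn_ord i; lia.
rewrite (bigD1 (Ordinal jm)) //= big1 ?addr0; first exact: hc.
by move=> i hi; apply: z; apply: contra hi => /eqP e; apply/eqP/val_inj.
Qed.

Lemma rect_diag_lb m k (A : 'M[C]_(m, k)) (c : R) (v : 'cV[C]_k) : rect_diag A ->
  (forall j, exists i, c <= cabs2 (A i j)) -> c * fro2 v <= fro2 (A *m v).
Proof.
move=> hA hc; rewrite rect_diag_fro2 // /fro2 mulr_sumr; apply: ler_sum => j _.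
rewrite big_ord1; apply: ler_wpM2r; first exact: cabs2_ge0.
have [i hi] := hc j; apply: le_trans hi _.
by rewrite (bigD1 i) //= lerDl sumr_ge0 // => i' _; apply: cabs2_ge0.
Qed.

(** Isometric inclusion of the first r coordinates; truncation becomes multiplication by an
    isometry, so norms can be followed. *)
Definition emb r m (h : (r <= m)%N) : 'M[C]_(m, r) := colsub (widen_ord h) 1%:M.

Lemma emb_unitary r m (h : (r <= m)%N) : unitary_cols (emb h).
Proof.
apply/matrixP => i j; rewrite !mxE (bigD1 (widen_ord h j)) //= big1.
  by rewrite !mxE eqxx mulr1 addr0 rmorph_nat eq_sym.
by move=> k /negbTE kj; rewrite !mxE kj mulr0.
Qed.

Lemma mul_embr r m k (h : (r <= m)%N) (A : 'M[C]_(k, m)) :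
  A *m emb h = colsub (widen_ord h) A.
Proof. by rewrite mulmx_colsub mulmx1. Qed.

Lemma mul_embl r m k (h : (r <= m)%N) (A : 'M[C]_(r, k)) i j :
  (emb h *m A) i j = if insub (nat_of_ord i) is Some i' then A i' j else 0.
Proof.
rewrite mxE; case: insubP => [i' lt_i e|hi].
  rewrite (bigD1 i') //= big1 => [|l hl].
    have -> : i = widen_ord h i' by apply: val_inj.
    by rewrite !mxE eqxx mul1r addr0.
  rewrite !mxE; case: eqP => [el|]; last by rewrite mul0r.
  by case/eqP: hl; apply: val_inj; rewrite /= e el.
rewrite big1 // => l _; rewrite !mxE; case: eqP => [el|]; last by rewrite mul0r.
by move: hi; rewrite el /= ltn_ord.
Qed.

Lemma lead_sub_widen m k a b (ha : (a <= m)%N) (hb : (b <= k)%N)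
    (A : 'M[C]_(m, k)) :
  lead_sub a b A = mxsub (widen_ord ha) (widen_ord hb) A.
Proof.
apply/matrixP => i j; rewrite !mxE.
rewrite (insubT (fun x => x < m)%N (leq_trans (ltn_ord i) ha)).
rewrite (insubT (fun x => x < k)%N (leq_trans (ltn_ord j) hb)).
by congr (A _ _); apply: val_inj.
Qed.

Lemma lead_sub_emb m k r (h : (r <= k)%N) (A : 'M[C]_(m, k)) :
  lead_sub m r A = A *m emb h :> 'M[C]_(m, r).
Proof.
rewrite (lead_sub_widen (leqnn m) h) mul_embr.
by apply/matrixP => i j; rewrite !mxE; congr (A _ _); apply: val_inj.
Qed.

Lemma wide_kernel r (A : 'M[C]_(r, r.+1)) :
  exists2 v : 'cV[C]_r.+1, A *m v = 0 & 0 < fro2 v.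
Proof.
have : kermx A^T != 0.
  rewrite -mxrank_eq0 mxrank_ker; have := rank_leq_col A^T; lia.
case/rowV0Pn => w /sub_kermxP wA w0; exists w^T.
  by rewrite -[A]trmxK -trmx_mul wA trmx0.
rewrite lt_neqAle fro2_ge0 andbT eq_sym; apply: contra w0 => /eqP/fro2_eq0 e.
by rewrite -[w]trmxK e trmx0.
Qed.

(** Weyl's inequality for the singular value number r + 1. The first r + 1 right singular vectors of
    [M] span a space that [ctr V] cannot map injectively, so it contains a nonzero vector killed by
    [Z], on which M - Z acts as M. *)
Lemma weyl_rank m k r (M Z : 'M[C]_(m, k)) (B : 'M[C]_(m, r)) (V : 'M[C]_(k, r))
    (U' : 'M[C]_m) (Sg : 'M[C]_(m, k)) (V' : 'M[C]_k) (e s : R) (hrk : (r < k)%N) :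
  Z = B *m ctr V -> opnorm_le (M - Z) e ->
  unitary_cols U' -> unitary_cols V' -> rect_diag Sg -> M = U' *m Sg *m ctr V' ->
  (forall j : 'I_r.+1, exists i, s <= cabs2 (Sg i (widen_ord hrk j))) ->
  s <= e ^+ 2.
Proof.
move=> eZ hMZ hU' hV' dSg eM hs.
have [W eW] : exists W, W = V' *m emb hrk by eexists.
have hW : unitary_cols W by rewrite eW; apply: unitary_colsM => //; apply: emb_unitary.
have [d Vd dp] := wide_kernel (ctr V *m W).
have h1 : fro2 ((M - Z) *m (W *m d)) = fro2 (colsub (widen_ord hrk) Sg *m d).
  rewrite mulmxBl eZ -!mulmxA (mulmxA (ctr V)) Vd mulmx0 subr0 eM -!mulmxA.
  rewrite (fro2_iso _ hU') -(mul_embr hrk Sg) eW -!mulmxA (mulmxA (ctr V') V').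
  by rewrite hV' mul1mx.
have h2 : s * fro2 d <= fro2 (colsub (widen_ord hrk) Sg *m d).
  apply: rect_diag_lb => [i j hij|j]; first by rewrite mxE dSg.
  by have [i hi] := hs j; exists i; rewrite mxE.
have := le_trans h2 (_ : _ <= e ^+ 2 * fro2 d); rewrite ler_pM2r //; apply.
by rewrite -h1 -(fro2_iso d hW); apply: hMZ.
Qed.

Lemma trunc_svdP m k r (M Z : 'M[C]_(m, k)) (B : 'M[C]_(m, r)) (V : 'M[C]_(k, r))
    (U0 : 'M[C]_(m, r)) (S0 : 'M[C]_r) (V0 : 'M[C]_(k, r)) (e : R) :
  (r <= m)%N -> (r <= k)%N -> is_trunc_svd M U0 S0 V0 ->
  Z = B *m ctr V -> opnorm_le (M - Z) e ->
  [/\ unitary_cols U0, unitary_cols V0, opnorm_le (M - U0 *m S0 *m ctr V0) e &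
    exists d : 'I_r -> R, [/\ forall i, 0 <= d i, S0 = real_diag d &
      forall i : 'I_r, nat_of_ord i = 0%N -> opnorm_le M (d i)]].
Proof.
move=> hm hk [U' [Sg [V' [hU' [hV' [dSg [pSg [mSg [eM [-> [-> ->]]]]]]]]]]] eZ hMZ.
have hV'c : unitary_cols (ctr V') by rewrite /unitary_cols ctrK unitary_colsC.
have eS : lead_sub r r Sg = mxsub (widen_ord hm) (widen_ord hk) Sg :> 'M_r.
  exact: lead_sub_widen.
rewrite (lead_sub_emb hm) (lead_sub_emb hk) eS.
set S0' := mxsub _ _ _.
split; try by apply: unitary_colsM => //; apply: emb_unitary.
  have -> : M - U' *m emb hm *m S0' *m ctr (V' *m emb hk) =
      U' *m (Sg - emb hm *m S0' *m ctr (emb hk)) *m ctr V'.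
    by rewrite ctrM mulmxBr mulmxBl eM !mulmxA.
  set T := Sg - _.
  (* [T] is [Sg] with its leading r by r block erased. *)
  have eT i j : T i j = Sg i j - if (i < r)%N && (j < r)%N then Sg i j else 0.
    rewrite [LHS]mxE [X in _ + X]mxE; congr (_ - _); rewrite -mulmxA mul_embl.
    case: insubP => [i' lt_i ei|/negbTE -> //]; rewrite lt_i.
    rewrite -[S0']ctrK -ctrM [LHS]mxE mxE mul_embl.
    case: insubP => [j' lt_j ej|/negbTE ->]; last by rewrite rmorph0.
    rewrite lt_j !mxE cconjK; congr (Sg _ _); apply: val_inj => /=.
      by rewrite ei.
    by rewrite ej.
  move=> v; rewrite -!mulmxA fro2_iso //.
  rewrite -[fro2 v](fro2_iso _ hV'c); move: (ctr V' *m v); apply: rect_diag_ub.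
    by move=> i j hij; rewrite eT dSg // if_same subrr.
  move=> i j hij; rewrite eT -hij andbb.
  case: ltnP => hir; first by rewrite subrr cabs2_0 sqr_ge0.
  rewrite subr0.
  have hrk : (r < k)%N by rewrite (leq_ltn_trans hir) // hij.
  have hrm : (r < m)%N by rewrite (leq_ltn_trans hir).
  (* Each of the first r + 1 diagonal entries dominates the one at position i >= r, which is
     therefore bounded by e. *)
  apply: (weyl_rank (hrk := hrk) eZ hMZ hU' hV' dSg eM) => l.
  have hl : (l < m)%N by apply: leq_ltn_trans hrm; rewrite -ltnS.
  exists (Ordinal hl); rewrite -!cabs_sqr ler_pXn2r ?nnegrE ?cabs_ge0 //.
  by apply: mSg => //=; apply: leq_trans hir; rewrite -ltnS.
exists (fun i => complex.Re (Sg (widen_ord hm i) (widen_ord hk i))); split.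
- by move=> i; have [|s [s0 ->]] := pSg (widen_ord hm i) (widen_ord hk i).
- apply/matrixP => i j; rewrite !mxE; case: (eqVneq i j) => [<-|ij].
    by rewrite mulr1n; have [|s [s0 ->]] := pSg (widen_ord hm i) (widen_ord hk i).
  by rewrite mulr0n dSg.
(* The entry of index 0 is the largest singular value and so bounds the whole operator. *)
- move=> i i0 v; rewrite eM -!mulmxA fro2_iso //.
  rewrite -[fro2 v](fro2_iso _ hV'c); move: (ctr V' *m v).
  apply: rect_diag_ub => // a b ab.
  have [|s [s0 es]] := pSg (widen_ord hm i) (widen_ord hk i) => //.
  rewrite es /= -(cabs2_real s) -es.
  rewrite -!cabs_sqr ler_pXn2r ?nnegrE ?cabs_ge0 //.
  by apply: mSg => //=; rewrite i0.
Qed.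

Lemma pythagoras m k r (A : 'M[C]_(m, k)) (V : 'M[C]_(k, r)) : unitary_cols V ->
  fro2 A = fro2 (A *m V) + fro2 (A *m (1%:M - V *m ctr V)).
Proof.
move=> hV; rewrite mulmxBr mulmx1 fro2B mulmxA fro2_isor //.
have -> : rip A (A *m V *m ctr V) = fro2 (A *m V).
  by rewrite fro2E /rip !mulmxA rtrC ctrM !mulmxA.
lra.
Qed.

(** M - Z is split by the projection onto the columns of [V]. The first part has r columns in an
    isometric frame; on the complement [Z] vanishes, so the image lies in the range of [U] and r
    rows suffice. Each part is at most r e^2. *)
Lemma lowrank_close m k r (M Z : 'M[C]_(m, k)) (U : 'M[C]_(m, r))
    (D : 'M[C]_(r, k)) (B : 'M[C]_(m, r)) (V : 'M[C]_(k, r)) (e : R) :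
  unitary_cols U -> unitary_cols V -> M = U *m D -> Z = B *m ctr V ->
  opnorm_le (M - Z) e -> fro2 (M - Z) <= 2 * r%:R * e ^+ 2.
Proof.
move=> hU hV eM eZ hE; set E := M - Z.
rewrite (pythagoras E hV); set P := 1%:M - _.
have h1 : fro2 (E *m V) <= e ^+ 2 * r%:R.
  by rewrite -(fro2_unitary hV); apply: opnorm_le_mx.
have ZP : Z *m P = 0.
  by rewrite eZ /P mulmxBr mulmx1 -!mulmxA (mulmxA (ctr V)) hV mul1mx subrr.
have EP : E *m P = U *m (ctr U *m E *m P).
  rewrite -!mulmxA [in RHS]mulmxBl [in LHS]mulmxBl ZP !subr0 eM.
  by rewrite -!mulmxA (mulmxA (ctr U)) hU mul1mx.
have h2 : fro2 (E *m P) <= e ^+ 2 * r%:R.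
  rewrite EP fro2_iso //; apply: le_trans (_ : fro2 (ctr U *m E) <= _).
    by rewrite [leRHS](pythagoras _ hV) -/P lerDr fro2_ge0.
  rewrite -fro2_ctr ctrM ctrK -(fro2_unitary hU).
  by apply: opnorm_le_mx; apply: opnorm_le_ctr.
lra.
Qed.

Lemma specnorm_ge m k (A : 'M[C]_(m, k)) (v : 'cV[C]_k) : frob v = 1 ->
  frob (A *m v) <= specnorm A.
Proof.
move=> hv; apply: ub_le_sup; last by exists v.
exists (frob A) => _ [w [hw ->]].
by have := opnorm_le_frob w (frob_ge0 A) (@opnorm_le_frobenius _ _ _ A); rewrite hw mulr1.
Qed.

End TruncatedSvd.

(** * Projections onto convex sets *)

Section Projection.
Variable R : realType.
Local Notation C := R[i].

(** Minimality of P along the segment towards Q gives <P - A, Q - P> >= 0, which is the cross term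
    when A - Q is split as (P - Q) + (A - P). *)
Lemma proj_nonexpansive m k (S : 'M[C]_(m, k) -> Prop) (A P Q : 'M[C]_(m, k)) :
  (forall X Y t, 0 <= t <= 1 -> S X -> S Y -> S (X + t%:C *: (Y - X))) ->
  is_proj S A P -> S Q -> fro2 (P - Q) <= fro2 (A - Q).
Proof.
move=> cS [SP hP] SQ; set x := rip (P - A) (Q - P); set y := fro2 (Q - P).
have y0 : 0 <= y by apply: fro2_ge0.
have h t : 0 < t <= 1 -> 0 <= 2 * x + t * y.
  move=> /andP[t0 t1].
  have hS : S (P + t%:C *: (Q - P)) by apply: cS => //; rewrite t1 ltW.
  have := hP _ hS; rewrite -(@ler_pXn2r _ 2) ?nnegrE ?frob_ge0 // !frob_sqr.
  rewrite addrAC (fro2D (P - A) (_ *: _)) fro2Z ripZr -/x -/y.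
  rewrite -addrA lerDl expr2 => hh.
  have : 0 <= t * (2 * x + t * y) by lra.
  by rewrite pmulr_rge0.
have x0 : 0 <= x.
  rewrite leNgt; apply/negP => xn.
  have d0 : 0 < y - x by lra.
  (* For this t the quantity 2 x + t y is at most x < 0, a contradiction; the choice also covers y =
     0. *)
  have /h : 0 < - x / (y - x) <= 1.
    by rewrite divr_gt0 ?ler_pdivrMr ?mul1r //=; lra.
  suff : - x / (y - x) * y <= - x by lra.
  rewrite mulrAC ler_pdivrMr // ler_wpM2l //; lra.
have -> : A - Q = (P - Q) + (A - P) by rewrite [RHS]addrC subrKA.
rewrite (fro2D (P - Q)).
have -> : rip (P - Q) (A - P) = x.
  by rewrite -(opprB P A) -(opprB Q P) ripNr ripC ripNr opprK.
have := fro2_ge0 (A - P); lra.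
Qed.

Lemma norm2inf_ge0 m k (A : 'M[C]_(m, k)) : 0 <= norm2inf A.
Proof.
rewrite /norm2inf; elim/big_ind: _ => // [x y x0 y0|i _]; last exact: sqrtr_ge0.
by rewrite le_max x0.
Qed.

Lemma norm2inf_le m k (A : 'M[C]_(m, k)) (c : R) : 0 <= c ->
  norm2inf A ^+ 2 <= c <-> forall i, fro2 (row i A) <= c.
Proof.
move=> c0; split => [h i|h].
  apply: le_trans h; rewrite -frob_sqr -rownormE.
  have : rownorm A i <= norm2inf A by apply: le_bigmax.
  by rewrite ler_pXn2r ?nnegrE ?sqrtr_ge0 ?norm2inf_ge0.
rewrite -[c]sqr_sqrtr // ler_pXn2r ?nnegrE ?sqrtr_ge0 ?norm2inf_ge0 //.
apply: bigmax_le => [|i _]; first exact: sqrtr_ge0.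
by rewrite rownormE ler_wsqrtr // -[leLHS]/(fro2 _).
Qed.

Lemma norm2inf_convex m k (c : R) (X Y : 'M[C]_(m, k)) t : 0 <= t <= 1 ->
  norm2inf X ^+ 2 <= c -> norm2inf Y ^+ 2 <= c ->
  norm2inf (X + t%:C *: (Y - X)) ^+ 2 <= c.
Proof.
move=> /andP[t0 t1] hX; have c0 : 0 <= c := le_trans (sqr_ge0 _) hX.
move: hX; rewrite !norm2inf_le // => hX hY i.
have -> : row i (X + t%:C *: (Y - X)) = (1 - t)%:C *: row i X + t%:C *: row i Y.
  apply/rowP => j; rewrite !mxE rmorphB rmorph1; ring.
have hf (z : 'rV[C]_k) : fro2 z <= c -> frob z <= Num.sqrt c by apply: ler_wsqrtr.
rewrite -frob_sqr -[c]sqr_sqrtr // ler_pXn2r ?nnegrE ?sqrtr_ge0 //.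
apply: le_trans (frobD _ _) _; rewrite !frobZ !ger0_norm //; last by lra.
have -> : Num.sqrt c = (1 - t) * Num.sqrt c + t * Num.sqrt c by ring.
by apply: lerD; apply: ler_wpM2l; rewrite ?hf //; lra.
Qed.

End Projection.

(** * Operator norm of Hankel matrices *)

Section HankelNorm.
Variable R : realType.
Local Notation C := R[i].

(** X^n - 1 splits over the algebraically closed field and is separable in characteristic 0; n
    distinct roots of unity of order dividing n include a primitive one. *)
Lemma complex_prim_root n : (0 < n)%N -> exists z : C, n.-primitive_root z.
Proof.
move=> n0; pose p : {poly C} := 'X^n - 1.
have [s Dp] := closed_field_poly_normal p.
rewrite (monicP _) ?monicXnsubC // scale1r in Dp.
have s1 : all n.-unity_root s by apply/allP => z; rewrite -root_prod_XsubC -Dp.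
have sz_s : (n < (size s).+1)%N by rewrite -(size_prod_XsubC s id) -Dp size_XnsubC.
have [|z _ hz] := hasP (has_prim_root n0 s1 _ sz_s); last by exists z.
by rewrite -separable_prod_XsubC -Dp separable_Xn_sub_1 // pnatr_eq0 -lt0n.
Qed.

Lemma prim_root_cabs2 n (z : C) : n.-primitive_root z -> cabs2 z = 1.
Proof.
move=> hz; have n0 := prim_order_gt0 hz.
have h k : cabs2 (z ^+ k) = cabs2 z ^+ k.
  elim: k => [|k IH]; first by rewrite !expr0 (cabs2_real 1) expr1n.
  by rewrite !exprS cabs2M IH.
have := h n; rewrite (prim_expr_order hz) (cabs2_real 1) expr1n => /esym/eqP.
by rewrite pexpr_eq1 ?cabs2_ge0 // => /eqP.
Qed.

(** The first m columns of the unnormalized Fourier matrix of size n, with one row per frequency. *)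
Definition dft n m (z : C) : 'M[C]_(n, m) := \matrix_(l, i) z ^+ (l * i).

(** Off the diagonal, [q] is an n-th root of unity other than 1, as i and j are distinct and below
    n, so the geometric sum of its powers vanishes. *)
Lemma dft_gram n m (z : C) : (m <= n)%N -> n.-primitive_root z ->
  ctr (dft n m z) *m dft n m z = (n%:R : R)%:C%:M.
Proof.
move=> mn hz; apply/matrixP => i j; rewrite !mxE.
have z1 := prim_root_cabs2 hz.
have zz : cconj z * z = 1 by rewrite cconj_mul z1.
have z0 : z != 0 by rewrite -cabs2_eq0 z1 oner_eq0.
pose q := cconj z ^+ i * z ^+ j.
have -> : \sum_(l < n) ctr (dft n m z) i l * dft n m z l j = \sum_(l < n) q ^+ l.
  apply: eq_bigr => l _; rewrite !mxE rmorphXn /q exprMn -!exprM.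
  by rewrite ![(l * _)%N]mulnC.
have [ij|ij] := eqVneq i j.
  rewrite mulr1n (eq_bigr (fun=> 1)) => [|l _].
    by rewrite sumr_const card_ord rmorph_nat.
  by rewrite /q -ij -exprMn zz expr1n expr1n.
rewrite mulr0n.
have q1 : q != 1.
  apply: contra ij => /eqP eq1; rewrite -val_eqE /=.
  have : z ^+ j == z ^+ i.
    apply/eqP; rewrite -[LHS]mul1r -[1](expr1n _ i) -zz exprMn.
    by rewrite mulrAC -/q eq1 mul1r.
  rewrite (eq_prim_root_expr hz) => /eqP; rewrite !modn_small => [->//||];
    by apply: leq_trans mn.
have qn : q ^+ n = 1.
  rewrite /q exprMn -!exprM ![(_ * n)%N]mulnC !exprM.
  by rewrite -rmorphXn (prim_expr_order hz) rmorph1 !expr1n mulr1.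
have := subrX1 q n; rewrite qn subrr => /esym/eqP.
by rewrite mulf_eq0 subr_eq0 (negbTE q1) => /eqP.
Qed.

Lemma opnorm_le_dft n m (z : C) : (m <= n)%N -> n.-primitive_root z ->
  opnorm_le (dft n m z) (Num.sqrt n%:R).
Proof.
move=> mn hz v; rewrite sqr_sqrtr ?ler0n // !fro2E ctrM -mulmxA.
by rewrite (mulmxA (ctr _) (dft _ _ _)) dft_gram // mul_scalar_mx -scalemxAr rtrZ.
Qed.

(** In Fourier inversion the exponent l (i + j) splits, so the Hankel matrix is n^-1 times a
    diagonal matrix of Fourier coefficients between two Fourier blocks of norm at most sqrt n. *)
Lemma opnorm_le_hankel n1 n2 (y : 'I_(n1 + n2).-1 -> C) (z : C) (c : R) :
  (0 < n1)%N -> (0 < n2)%N -> ((n1 + n2).-1).-primitive_root z ->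
  (forall l : 'I_(n1 + n2).-1, cabs (\sum_k y k * z ^+ (l * k)) <= c) ->
  opnorm_le (hankel n1 n2 y) c.
Proof.
move=> n1p n2p hz hc; set n := (n1 + n2).-1 in y hz hc *.
have h1 : (n1 <= n)%N by rewrite /n; lia.
have h2 : (n2 <= n)%N by rewrite /n; lia.
have n0 : (0 < n)%N by apply: leq_trans h1.
pose yh l := \sum_k y k * z ^+ (l * k).
pose D : 'M[C]_n := diag_mx (\row_l yh l).
have hz' : n.-primitive_root (cconj z) by rewrite fmorph_primitive_root.
have nR : (n%:R : R) != 0 by rewrite pnatr_eq0 -lt0n.
have inv (k0 : 'I_n) : \sum_(l < n) yh l * cconj z ^+ (l * k0) = (n%:R : R)%:C * y k0.
  transitivity (\sum_k y k * (ctr (dft n n z) *m dft n n z) k0 k).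
    rewrite (eq_bigr (fun l : 'I_n => \sum_k y k * (ctr (dft n n z) k0 l * dft n n z l k))).
      rewrite exchange_big; apply: eq_bigr => k _.
      by rewrite [in RHS]mxE mulr_sumr.
    move=> l _; rewrite /yh mulr_suml; apply: eq_bigr => k _.
    by rewrite !mxE rmorphXn -mulrA; congr (_ * _); apply: mulrC.
  rewrite dft_gram // (bigD1 k0) //= big1 => [|k].
    by rewrite !mxE eqxx mulr1n addr0 mulrC.
  by rewrite eq_sym !mxE => /negbTE ->; rewrite mulr0n mulr0.
have eH : hankel n1 n2 y =
    (n%:R^-1 : R)%:C *: (ctr (dft n n1 z) *m D *m dft n n2 (cconj z)).
  apply/matrixP => i j; rewrite [LHS]mxE [RHS]mxE -mulmxA [X in _ * X]mxE.
  rewrite (eq_bigr (fun l : 'I_n => yh l * cconj z ^+ (l * hidx i j))).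
    by rewrite inv mulrA -rmorphM mulVf // rmorph1 mul1r.
  move=> l _; rewrite mul_diag_mx !mxE rmorphXn /= mulnDr exprD.
  by rewrite mulrCA.
have hD : opnorm_le D c.
  apply: rect_diag_ub => [i j ij|i j ij].
    by rewrite !mxE (_ : (i == j) = false) ?mulr0n //; apply/negbTE.
  rewrite !mxE (_ : i == j) ?mulr1n; last by apply/eqP/val_inj.
  rewrite -cabs_sqr ler_pXn2r ?nnegrE ?cabs_ge0 ?hc //.
  exact: le_trans (cabs_ge0 _) (hc i).
move=> v; rewrite eH -scalemxAl fro2Z -!mulmxA.
apply: le_trans (_ : n%:R^-1 ^+ 2 * (n%:R * (c ^+ 2 * (n%:R * fro2 v))) <= _).
  have s2 := sqr_sqrtr (ler0n R n).
  rewrite ler_wpM2l ?sqr_ge0 //.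
  apply: le_trans (opnorm_le_ctr (opnorm_le_dft h1 hz) _) _; rewrite s2 ler_wpM2l ?ler0n //.
  apply: le_trans (hD _) _; rewrite ler_wpM2l ?sqr_ge0 //.
  by apply: le_trans (opnorm_le_dft h2 hz' _) _; rewrite s2.
rewrite le_eqVlt; apply/orP; left; apply/eqP; field.
by rewrite nR.
Qed.

End HankelNorm.

(** * Bernoulli sampling *)

Section Bernoulli.
Variable R : realType.
Local Notation C := R[i].

(** exp (- u) >= 1 - u gives exp u <= 1 / (1 - u), and (1 + u + 2 u^2) (1 - u) = 1 + u^2 (1 - 2 u)
    >= 1. *)
Lemma expR_le_quadratic (u : R) : u <= 1 / 2 -> expR u <= 1 + u + 2 * u ^+ 2.
Proof.
move=> hu; have h1 : 0 < 1 - u by lra.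
have h2 : 1 - u <= expR (- u) := expR_ge1Dx (- u).
apply: le_trans (_ : (1 - u)^-1 <= _).
  by rewrite -[expR u]invrK -expRN lef_pV2 ?posrE ?expR_gt0.
rewrite -[_^-1]mul1r ler_pdivrMr //.
have : 0 <= u ^+ 2 * (1 - 2 * u) by apply: mulr_ge0; [exact: sqr_ge0|lra].
lra.
Qed.

Section Weights.
Variables (n : nat) (p : R).
Hypotheses (p0 : 0 < p) (p1 : p <= 1).
Implicit Types (E F : {set {set 'I_n}}).

Lemma bern_weight (O : {set 'I_n}) (g : 'I_n -> bool -> R) :
  p ^+ #|O| * (1 - p) ^+ (n - #|O|) * \prod_k g k (k \in O) =
  \prod_k (if k \in O then p * g k true else (1 - p) * g k false).
Proof.
have -> : p ^+ #|O| * (1 - p) ^+ (n - #|O|) =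
    \prod_(k < n) (if k \in O then p else 1 - p).
  rewrite (bigID (mem O)) /=; congr (_ * _).
    by rewrite (eq_bigr (fun=> p)) ?prodr_const // => k ->.
  rewrite (eq_bigr (fun=> 1 - p)) => [|k /negbTE -> //].
  rewrite prodr_const; congr (_ ^+ _).
  rewrite -[n in (n - _)%N]card_ord -(cardC (mem O)) addKn.
  by apply: eq_card => k; rewrite !inE.
by rewrite -big_split; apply: eq_bigr => k _ /=; case: (k \in O).
Qed.

(** Expanding the right-hand product over subsets gives the left-hand sum; this is where
    independence of the samples enters. *)
Lemma bern_expectation (g : 'I_n -> bool -> R) :
  \sum_(O : {set 'I_n}) p ^+ #|O| * (1 - p) ^+ (n - #|O|) * \prod_k g k (k \in O) =
  \prod_k (p * g k true + (1 - p) * g k false).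
Proof. by rewrite bigA_distr; apply: eq_bigr => O _; rewrite bern_weight. Qed.

Lemma bern_weight_ge0 (O : {set 'I_n}) : 0 <= p ^+ #|O| * (1 - p) ^+ (n - #|O|).
Proof. by rewrite mulr_ge0 ?exprn_ge0 ?subr_ge0 ?(ltW p0). Qed.

Lemma bern_probT : bern_prob p [set: {set 'I_n}] = 1.
Proof.
have := bern_expectation (fun _ _ => 1); rewrite [RHS]big1 => [<-|k _]; last by lra.
rewrite /bern_prob; apply: eq_big => [O|O _]; first by rewrite inE.
by rewrite big1 ?mulr1.
Qed.

Lemma bern_probC E : bern_prob p E = 1 - bern_prob p (~: E).
Proof.
apply/esym/eqP; rewrite subr_eq -bern_probT /bern_prob (bigID (mem E)) /=.
by apply/eqP; congr (_ + _); apply: eq_bigl => O; rewrite !inE.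
Qed.

Lemma bern_probU E F : bern_prob p (E :|: F) <= bern_prob p E + bern_prob p F.
Proof.
rewrite /bern_prob ![X in X <= _]big_mkcond ![X in _ <= X + _]big_mkcond.
rewrite ![X in _ <= _ + X]big_mkcond -big_split.
apply: ler_sum => O _ /=; rewrite inE; have := bern_weight_ge0 O.
by case: (O \in E); case: (O \in F) => /=; lra.
Qed.

Lemma bern_prob_sub E F : E \subset F -> bern_prob p E <= bern_prob p F.
Proof.
move=> /fintype.subsetP EF; rewrite /bern_prob [leLHS]big_mkcond [leRHS]big_mkcond.
apply: ler_sum => O _; have := bern_weight_ge0 O; case: ifP => [/EF -> //|_].
by case: ifP.
Qed.

Lemma bern_prob_bigcup (I : finType) (F : I -> {set {set 'I_n}}) :
  bern_prob p (\bigcup_i F i) <= \sum_i bern_prob p (F i).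
Proof.
elim/big_rec2: _ => [|i y G _ h]; first by rewrite /bern_prob big_set0.
by apply: le_trans (bern_probU _ _) _; rewrite lerD2l.
Qed.

Definition noise (O : {set 'I_n}) (k : 'I_n) : R := (k \in O)%:R / p - 1.

Lemma chernoff (a : 'I_n -> R) (lam tau : R) : 0 <= lam ->
  (forall k, lam * `|a k| <= p / 2) ->
  bern_prob p [set O | tau < \sum_k noise O k * a k]
    <= expR (2 * lam ^+ 2 / p * (\sum_k a k ^+ 2) - lam * tau).
Proof.
move=> lam0 ha; set A := [set O | _].
pose g k (b : bool) := expR (lam * ((b%:R / p - 1) * a k)).
(* Markov's inequality for the exponential of [lam] times the sum. *)
have h O : O \in A -> 1 <= expR (- (lam * tau)) * \prod_k g k (k \in O).
  rewrite inE => hO.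
  have -> : \prod_k g k (k \in O) = expR (lam * \sum_k noise O k * a k).
    by rewrite mulr_sumr expR_sum.
  rewrite -expRD -[leLHS]expR0 ler_expR addrC subr_ge0.
  by rewrite ler_wpM2l // ltW.
apply: le_trans (_ : expR (- (lam * tau)) *
    \sum_(O : {set 'I_n}) p ^+ #|O| * (1 - p) ^+ (n - #|O|) * \prod_k g k (k \in O) <= _).
  rewrite mulr_sumr /bern_prob big_mkcond; apply: ler_sum => O _.
  have w0 := bern_weight_ge0 O.
  have g0 : 0 <= \prod_k g k (k \in O) by apply: prodr_ge0 => k _; apply: expR_ge0.
  case: ifP => [/h hO|_]; last by rewrite mulr_ge0 ?expR_ge0 ?(mulr_ge0 w0).
  by rewrite mulrCA -[leLHS]mulr1 ler_wpM2l.
rewrite bern_expectation expRD mulrC ler_wpM2r ?expR_ge0 //.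
rewrite mulr_sumr expR_sum; apply: ler_prod => k _; rewrite /g /=.
apply/andP; split.
  by apply: addr_ge0; apply: mulr_ge0; rewrite ?expR_ge0 ?subr_ge0 ?(ltW p0).
have [q q1] : exists q, p * q = 1 by exists p^-1; rewrite mulfV ?gt_eqF.
have eq : p^-1 = q by rewrite -[RHS](mulKf (x := p)) ?gt_eqF // q1 mulr1.
have q0 : 0 < q by rewrite -eq invr_gt0.
have hk := ha k; set b := a k in hk *.
have hb : lam * b <= p / 2 /\ - (lam * b) <= p / 2.
  split; apply: le_trans hk; rewrite -?mulrN ler_wpM2l // ?ler_norm //.
  by rewrite -normrN ler_norm.
case: hb => hb1 hb2.
rewrite mul1r mul0r sub0r eq.
set u := lam * ((q - 1) * b); set v := lam * (-1 * b).
have pp : p * 1 = p by rewrite mulr1.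
have hu : u <= 1 / 2.
  have -> : u = (q - 1) * (lam * b) by rewrite /u; ring.
  have q1' : 0 <= q - 1.
    have : p * 1 <= p * q by rewrite q1 mulr1.
    by rewrite ler_pM2l // subr_ge0.
  apply: le_trans (_ : (q - 1) * (p / 2) <= _); first by rewrite ler_wpM2l.
  have -> : (q - 1) * (p / 2) = (p * q - p) / 2 by ring.
  rewrite q1; lra.
have hv : v <= 1 / 2.
  have -> : v = - (lam * b) by rewrite /v; ring.
  by apply: le_trans hb2 _; rewrite ler_pM2r // invr_gt0.
apply: le_trans (_ : p * (1 + u + 2 * u ^+ 2) + (1 - p) * (1 + v + 2 * v ^+ 2) <= _).
  by apply: lerD; apply: ler_wpM2l; rewrite ?expR_le_quadratic ?subr_ge0 ?(ltW p0).
apply: le_trans (expR_ge1Dx _).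
(* The middle term has the factor p q - 1 = 0, since the noise is centred; the q - 1 in the last
   term is its variance. *)
have -> : p * (1 + u + 2 * u ^+ 2) + (1 - p) * (1 + v + 2 * v ^+ 2)
  = 1 + (p * q - 1) * (lam * b) * (1 + 2 * (lam * b) * (q - 2)) + 2 * lam ^+ 2 * b ^+ 2 * (q - 1).
  by rewrite /u /v; ring.
rewrite q1 subrr !mul0r addr0 lerD2l.
have : 0 <= 2 * lam ^+ 2 * b ^+ 2.
  by rewrite mulr_ge0 ?sqr_ge0 // mulr_ge0 ?sqr_ge0.
lra.
Qed.

(** A modulus above 2 tau forces the real part, the imaginary part or the opposite of one of them
    above tau; these four events give the factor 4. *)
Lemma chernoff_complex (x : 'I_n -> C) (lam tau : R) : 0 <= lam ->
  (forall k, lam * cabs (x k) <= p / 2) ->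
  bern_prob p [set O | 2 * tau < cabs (\sum_k (noise O k)%:C * x k)]
    <= 4 * expR (2 * lam ^+ 2 / p * (\sum_k cabs2 (x k)) - lam * tau).
Proof.
move=> lam0 hx.
set B := expR _.
have hB (a : 'I_n -> R) : (forall k, `|a k| <= cabs (x k)) ->
    bern_prob p [set O | tau < \sum_k noise O k * a k] <= B.
  move=> ha; apply: le_trans (chernoff _ lam0 _) _ => [k|].
    by apply: le_trans (hx k); rewrite ler_wpM2l.
  rewrite ler_expR lerD2r ler_wpM2l //.
    by rewrite divr_ge0 ?mulr_ge0 ?sqr_ge0 // ltW.
  apply: ler_sum => k _; rewrite -cabs_sqr -real_normK ?num_real //.
  by rewrite ler_pXn2r ?nnegrE ?cabs_ge0.
pose re k := complex.Re (x k); pose im k := complex.Im (x k).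
have h1 := hB re (fun k => Re_le_cabs (x k)).
have h2 := hB im (fun k => Im_le_cabs (x k)).
have /hB h3 : forall k, `|- re k| <= cabs (x k) by move=> k; rewrite normrN Re_le_cabs.
have /hB h4 : forall k, `|- im k| <= cabs (x k) by move=> k; rewrite normrN Im_le_cabs.
set E1 := [set O | _] in h1; set E2 := [set O | _] in h2.
set E3 := [set O | _] in h3; set E4 := [set O | _] in h4.
apply: le_trans (_ : bern_prob p ((E1 :|: E2) :|: (E3 :|: E4)) <= _).
  apply: bern_prob_sub; apply/fintype.subsetP => O; rewrite !inE => hO.
  have hn (f : 'I_n -> R) : \sum_k noise O k * - f k = - \sum_k noise O k * f k.
    by rewrite -sumrN; apply: eq_bigr => k _; rewrite mulrN.
  rewrite !hn; have := lt_le_trans hO (cabs_le_ReIm _).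
  rewrite Re_sum Im_sum.
  rewrite (eq_bigr (fun k => noise O k * re k)) => [|k _]; last exact: ReZ.
  rewrite [X in _ + `|X|](eq_bigr (fun k => noise O k * im k)) => [|k _]; last exact: ImZ.
  move: (\sum_k _) (\sum_k _) => s t.
  case: (ltP tau s); case: (ltP tau t); case: (ltP tau (- s)); case: (ltP tau (- t)) => //=.
  move=> t1 s1 t2 s2; have : `|s| <= tau by rewrite ler_norml lerNl s1 s2.
  have : `|t| <= tau by rewrite ler_norml lerNl t1 t2.
  lra.
apply: le_trans (bern_probU _ _) _.
apply: le_trans (lerD (bern_probU _ _) (bern_probU _ _)) _.
lra.
Qed.

End Weights.

End Bernoulli.

(** * Incoherence and thresholding *)

Section Incoherence.
Variable R : realType.
Local Notation C := R[i].

Lemma rdiagE r (d : nat -> R) : rdiag r d = real_diag (fun i : 'I_r => d i).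
Proof.
apply/matrixP => i j; rewrite !mxE.
by case: eqP => [->|_]; rewrite ?mulr1n ?mulr0n.
Qed.

Lemma rect_diag_real_diag r (d : 'I_r -> R) : rect_diag (real_diag d).
Proof.
move=> i j ij; rewrite !mxE (_ : (i == j) = false) ?mulr0n //.
by apply: contra_neqF ij => /eqP ->.
Qed.

Lemma opnorm_le_real_diag r (d : 'I_r -> R) (c : R) :
  (forall i, 0 <= d i <= c) -> opnorm_le (real_diag d) c.
Proof.
move=> hd; apply: rect_diag_ub (@rect_diag_real_diag _ _) _ => i j ij.
have {j ij} <- : i = j by apply: val_inj.
rewrite !mxE eqxx mulr1n cabs2_real; have /andP[d0 dc] := hd i.
by rewrite ler_pXn2r ?nnegrE // (le_trans d0).
Qed.

Lemma real_diag_lb r (d : 'I_r -> R) (c : R) j (v : 'M[C]_(r, j)) :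
  0 <= c -> (forall i, c <= d i) -> c ^+ 2 * fro2 v <= fro2 (real_diag d *m v).
Proof.
move=> c0 hd; rewrite [fro2 v]fro2_cols [leRHS]fro2_cols mulr_sumr.
apply: ler_sum => l _; rewrite !colE -mulmxA; apply: rect_diag_lb (@rect_diag_real_diag _ _) _.
move=> i; exists i; rewrite !mxE eqxx mulr1n cabs2_real.
by rewrite ler_pXn2r ?nnegrE // (le_trans c0).
Qed.

Lemma sqrt_real_diag r (d : 'I_r -> R) :
  sqrt_diag (real_diag d) = real_diag (fun i => Num.sqrt (d i)).
Proof.
apply/matrixP => i j; rewrite !mxE; case: eqP => _; rewrite ?mulr1n ?mulr0n //.
by rewrite /= sqrtr0.
Qed.

Section LowRank.
Variables (m k r : nat) (U : 'M[C]_(m, r)) (V : 'M[C]_(k, r)) (d : 'I_r -> R).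
Variables (b s : R).
Hypotheses (hU : unitary_cols U) (hV : unitary_cols V).
Hypotheses (hb : forall i, fro2 (row i U) <= b) (hd : forall i, 0 <= d i <= s).
Let Z := U *m real_diag d *m ctr V.

Lemma row_scaled_le i : fro2 (row i (U *m real_diag d)) <= s ^+ 2 * b.
Proof.
rewrite row_mul -fro2_ctr ctrM ctr_real_diag.
apply: le_trans (opnorm_le_real_diag hd _) _; rewrite ler_wpM2l ?sqr_ge0 //.
by rewrite fro2_ctr.
Qed.

Lemma row_lowrank_le i : fro2 (row i Z) <= s ^+ 2 * b.
Proof. by rewrite row_mul fro2_isor // row_scaled_le. Qed.

(** The entry is the inner product of a scaled row of [U] with a row of [V]; Cauchy-Schwarz enters
    as [opnorm_le_frobenius] for a single row. *)
Lemma entry_lowrank_le i j : (forall j, fro2 (row j V) <= b) ->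
  cabs2 (Z i j) <= (s * b) ^+ 2.
Proof.
move=> hb'; have b0 : 0 <= b := le_trans (fro2_ge0 _) (hb i).
have -> : cabs2 (Z i j) = fro2 (row i (U *m real_diag d) *m ctr (row j V)).
  rewrite /fro2 !big_ord1 /Z mxE [in RHS]mxE; congr cabs2.
  by apply: eq_bigr => l _; rewrite !mxE.
apply: le_trans (opnorm_le_frobenius _ _) _; rewrite frob_sqr fro2_ctr exprMn expr2 mulrA.
by apply: ler_pM; rewrite ?fro2_ge0 ?row_scaled_le.
Qed.

End LowRank.

(** Counting from 0, the entry is (0, k) if k < n2 and (k - (n2 - 1), n2 - 1) otherwise. *)
Lemma hidx_border n1 n2 (k : 'I_(n1 + n2).-1) :
  (0 < n1)%N -> (0 < n2)%N ->
  (exists j, forall i : 'I_n1, nat_of_ord i = 0%N -> hidx i j = k) \/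
  (exists i, forall j : 'I_n2, nat_of_ord j = n2.-1 -> hidx i j = k).
Proof.
move=> h1 h2; have hk := ltn_ord k; have [kn|nk] := ltnP k n2.
  by left; exists (Ordinal kn) => i i0; apply: val_inj; rewrite /= i0.
right; have hi : (k - n2.-1 < n1)%N by lia.
by exists (Ordinal hi) => j j0; apply: val_inj; rewrite /= j0; lia.
Qed.

Lemma hidx_surj n1 n2 (k : 'I_(n1 + n2).-1) : (0 < n1)%N -> (0 < n2)%N ->
  exists (i : 'I_n1) (j : 'I_n2), hidx i j = k.
Proof.
move=> h1 h2; have l2 : (n2.-1 < n2)%N by lia.
case: (hidx_border k h1 h2) => [[j hj]|[i hi]].
  by exists (Ordinal h1), j; apply: hj.
by exists i, (Ordinal l2); apply: hi.
Qed.

Lemma sum_hankel_le n1 n2 (x : 'I_(n1 + n2).-1 -> C) (b : R) :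
  (0 < n1)%N -> (0 < n2)%N ->
  (forall i, fro2 (row i (hankel n1 n2 x)) <= b) ->
  (forall j, fro2 (row j (ctr (hankel n1 n2 x))) <= b) ->
  \sum_k cabs2 (x k) <= 2 * b.
Proof.
move=> h1 h2 hr hc; have l2 : (n2.-1 < n2)%N by lia.
pose i0 := Ordinal h1; pose j0 := Ordinal l2.
apply: le_trans (_ : \sum_j cabs2 (x (hidx i0 j)) + \sum_i cabs2 (x (hidx i j0)) <= _).
  have e (I : finType) (f : I -> 'I_(n1 + n2).-1) :
      \sum_i cabs2 (x (f i)) = \sum_k \sum_i (f i == k)%:R * cabs2 (x k).
    rewrite exchange_big; apply: eq_bigr => i _.
    rewrite (bigD1 (f i)) //= eqxx mul1r big1 ?addr0 // => k.
    by rewrite eq_sym => /negbTE ->; rewrite mul0r.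
  rewrite (e _ (hidx i0)) (e _ (fun i => hidx i j0)) -big_split; apply: ler_sum => k _ /=.
  have p (I : finType) (f : I -> 'I_(n1 + n2).-1) (P : pred I) :
      0 <= \sum_(i | P i) (f i == k)%:R * cabs2 (x k).
    by apply: sumr_ge0 => i _; rewrite mulr_ge0 ?cabs2_ge0.
  case: (hidx_border k h1 h2) => [[j hj]|[i hi]].
    rewrite (bigD1 j) //= (hj i0 erefl) eqxx mul1r -addrA lerDl.
    by apply: addr_ge0; apply: p.
  rewrite [X in _ + X](bigD1 i) //= (hi j0 erefl) eqxx mul1r [leRHS]addrCA lerDl.
  by apply: addr_ge0; apply: p.
have -> : 2 * b = b + b by lra.
apply: lerD.
  apply: le_trans (hr i0); rewrite /fro2 big_ord1.
  by apply: ler_sum => j _; rewrite !mxE.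
apply: le_trans (hc j0); rewrite /fro2 big_ord1.
by apply: ler_sum => j _; rewrite !mxE cabs2_conj.
Qed.

End Incoherence.

Section Thresholding.
Variable R : realType.
Local Notation C := R[i].

(** On the kept set [S] the error is - x k. Off [S], where t k is nonzero, some kept j lies outside
    the support of t, so |y k| <= |y j| = |x j| and |t k| <= 2 X. Both sets have at most K elements,
    whence 3 K X. *)
Lemma threshold_error n (K : nat) (x t y w : 'I_n -> C) (X : R) : 0 <= X ->
  (forall k, cabs (x k) <= X) -> (forall k, y k = x k + t k) ->
  (l0 t <= K)%N -> is_Gamma K y w ->
  \sum_k cabs (t k - w k) <= 3 * K%:R * X.
Proof.
move=> X0 hx hy ht [S [cS [oS ->]]]; set T := [set k | t k != 0].
have cT : (#|T| <= K)%N by [].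
have h k : cabs (t k - PiO S y k) <= (k \in S)%:R * X + (k \in T)%:R * (2 * X).
  rewrite /PiO; case: ifP => kS.
    rewrite hy opprD addrCA subrr addr0 cabsN mul1r.
    by apply: le_trans (hx k) _; rewrite lerDl mulr_ge0 ?mulr_ge0.
  rewrite subr0 mul0r add0r inE; case: eqP => [->|/eqP tk] /=.
    by rewrite cabs0 mul0r.
  rewrite mul1r.
  have kT : k \in T by rewrite inE.
  (* If [S] were inside [T], it would be proper because k is in [T] only, so |S| < |T| <= min (K, n)
     = |S|. *)
  have [ST|] := boolP (S \subset T).
    have : (#|S| < #|T|)%N.
      apply: proper_card; rewrite properE ST /=; apply/negP.
      by move=> /fintype.subsetP/(_ k kT); rewrite kS.
    have Tn : (#|T| <= n)%N by rewrite -[leqRHS]card_ord max_card.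
    by rewrite cS ltnNge leq_min cT Tn.
  move=> /fintype.subsetPn [j jS jT].
  have tj : t j = 0 by move: jT; rewrite inE negbK => /eqP.
  have := oS j k jS (negbT kS); rewrite (hy j) tj addr0 => hyk.
  have -> : t k = y k - x k by rewrite hy addrC addKr.
  apply: le_trans (cabsD _ _) _; rewrite cabsN.
  have := hx j; have := hx k; lra.
apply: le_trans (ler_sum _ (fun k _ => h k)) _.
rewrite big_split /= -!mulr_suml -!natr_sum.
have card_sum (A : {set 'I_n}) : (\sum_(k < n) (k \in A) = #|A|)%N.
  by rewrite -sum1_card [RHS]big_mkcond /=; apply: eq_bigr => k _; case: (k \in A).
rewrite !card_sum.
have hS : (#|S|%:R : R) <= K%:R by rewrite ler_nat cS geq_minl.
have hT : (#|T|%:R : R) <= K%:R by rewrite ler_nat.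
apply: le_trans (_ : K%:R * X + K%:R * (2 * X) <= _); last by lra.
by apply: lerD; apply: ler_wpM2r; rewrite ?mulr_ge0.
Qed.

End Thresholding.

(** * Spectral initialization *)

Section Initialization.
Variable R : realType.
Local Notation C := R[i].

Lemma fro2_delta n (i : 'I_n) : fro2 (delta_mx i 0 : 'cV[C]_n) = 1.
Proof.
rewrite /fro2 (bigD1 i) //= big_ord1 mxE !eqxx (cabs2_real 1) expr1n.
rewrite big1 ?addr0 // => j /negbTE ji.
by rewrite big_ord1 mxE ji (cabs2_real 0) expr0n.
Qed.

Lemma real_diag_delta n (d : 'I_n -> R) (i : 'I_n) :
  real_diag d *m delta_mx i 0 = (d i)%:C *: delta_mx i 0 :> 'cV[C]_n.
Proof.
apply/matrixP => j l; rewrite mul_diag_mx !mxE.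
by case: eqP => [->|_] //=; rewrite !mulr0.
Qed.

Lemma noise_dft_event n (x : 'I_n -> C) (z : C) (p b s g : R) :
  (1 < n)%N -> 0 < p -> p <= 1 -> 0 < b -> 0 < s ->
  (forall k, cabs (x k) <= s * b) -> \sum_k cabs2 (x k) <= 2 * (s ^+ 2 * b) ->
  cabs2 z = 1 -> 0 < g -> g <= 1 / 2 -> g ^+ 2 = b * ln n%:R / p ->
  exists E : {set {set 'I_n}}, 1 - 2 / n%:R ^+ 2 <= bern_prob p E /\
    forall O, O \in E -> forall l : 'I_n,
      cabs (\sum_k ((noise p O k)%:C * x k) * z ^+ (l * k)) <= 16 * (s * g).
Proof.
move=> n1 p0 p1 b0 s0 hx hx2 hz g0 g1 hg.
have cz k : cabs2 (z ^+ k) = 1.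
  by elim: k => [|k IH]; rewrite ?expr0 ?(cabs2_real 1) ?expr1n // exprS cabs2M hz IH mulr1.
pose xl (l k : 'I_n) := x k * z ^+ (l * k).
pose bad l := [set O | 2 * (8 * (s * g)) < cabs (\sum_k (noise p O k)%:C * xl l k)].
exists (~: \bigcup_l bad l)%SET; split; last first.
  move=> O; rewrite inE => hO l; rewrite leNgt; apply: contra hO => hl.
  apply/bigcupP; exists l => //; rewrite inE.
  rewrite (_ : 2 * (8 * (s * g)) = 16 * (s * g)); last by ring.
  by under eq_bigr => k _ do rewrite /xl mulrA.
rewrite bern_probC finset.setCK lerD2l lerN2.
apply: le_trans (bern_prob_bigcup p0 p1 _) _.
have nn : (0 : R) < n%:R by rewrite ltr0n ltnW.
(* This value makes the Chernoff exponent 4 ln n - 8 ln n = -4 ln n. Each frequency then fails with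
   probability at most 4 n^-4, and the union over n frequencies costs at most 2 n^-2 as n >= 2. *)
pose lam := g * p / (b * s).
have lam0 : 0 <= lam by rewrite divr_ge0 ?mulr_ge0 ?ltW.
have hbad l : bern_prob p (bad l) <= 4 / n%:R ^+ 4.
  apply: le_trans (chernoff_complex p0 p1 _ lam0 _) _ => [k|].
    have -> : cabs (xl l k) = cabs (x k) by rewrite /cabs cabs2M cz mulr1.
    apply: le_trans (_ : lam * (s * b) <= _); first by rewrite ler_wpM2l.
    have -> : lam * (s * b) = g * p by rewrite /lam; field; rewrite !gt_eqF.
    have := ler_wpM2r (ltW p0) g1; lra.
  apply: ler_wpM2l => //.
  have -> : \sum_k cabs2 (xl l k) = \sum_k cabs2 (x k).
    by apply: eq_bigr => k _; rewrite cabs2M cz mulr1.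
  have en : expR (- (4%:R * ln n%:R)) = (n%:R ^+ 4)^-1 :> R.
    by rewrite expRN expRM_natl lnK // posrE.
  rewrite -en ler_expR.
  apply: le_trans (_ : 2 * lam ^+ 2 / p * (2 * (s ^+ 2 * b)) - lam * (8 * (s * g)) <= _).
    by rewrite lerD2r ler_wpM2l // divr_ge0 ?(ltW p0) // mulr_ge0 ?sqr_ge0.
  have -> : ln n%:R = g ^+ 2 * p / b by rewrite hg; field; rewrite !gt_eqF.
  rewrite le_eqVlt; apply/orP; left; apply/eqP; rewrite /lam; field.
  by rewrite !gt_eqF.
apply: le_trans (ler_sum _ (fun l _ => hbad l)) _.
rewrite sumr_const card_ord -[leLHS]mulr_natl.
have n2 : (2 : R) <= n%:R by rewrite ler_nat.
have -> : n%:R * (4 / n%:R ^+ 4) = 2 * 2 / n%:R ^+ 3 :> R by field; rewrite gt_eqF.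
rewrite ler_pdivrMr ?exprn_gt0 //.
have -> : 2 / n%:R ^+ 2 * n%:R ^+ 3 = 2 * n%:R :> R by field; rewrite gt_eqF.
by rewrite ler_wpM2l.
Qed.

Section Core.
Variables (m k r : nat) (Un : 'M[C]_(m, r)) (Vn : 'M[C]_(k, r)) (d : 'I_r -> R).
Variables (i0 : 'I_r) (s b e : R) (M : 'M[C]_(m, k)).
Hypotheses (hi0 : nat_of_ord i0 = 0%N) (hrm : (r <= m)%N) (hrk : (r <= k)%N).
Hypotheses (hUn : unitary_cols Un) (hVn : unitary_cols Vn).
Hypotheses (hbU : forall i, fro2 (row i Un) <= b).
Hypotheses (hbV : forall i, fro2 (row i Vn) <= b).
Hypotheses (b0 : 0 <= b) (s0 : 0 < s) (hd : forall i, s <= d i <= d i0).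
Hypotheses (e0 : 0 <= e) (es : e <= s / 4).
Let Z := Un *m real_diag d *m ctr Vn.
Hypothesis hM : opnorm_le (M - Z) e.
Let sq i := Num.sqrt (d i).

Let d0 i : 0 < d i. Proof. by have /andP[h _] := hd i; apply: lt_le_trans h. Qed.

Let sq2 : real_diag sq *m real_diag sq = real_diag d.
Proof. by rewrite real_diagM; apply: eq_real_diag => i; rewrite -expr2 sqr_sqrtr // ltW. Qed.

Lemma gram_factor p (U : 'M[C]_(p, r)) (f : 'I_r -> R) : unitary_cols U ->
  ctr (U *m real_diag f) *m (U *m real_diag f) = real_diag f *m real_diag f.
Proof. by move=> hU; rewrite ctrM ctr_real_diag -!mulmxA (mulmxA (ctr U)) hU mul1mx. Qed.

(** The bound on [M] is tested on the i-th right singular vector of [Z], whose image under [Z] has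
    length d i. *)
Lemma top_le (i : 'I_r) (t : R) : 0 <= t -> opnorm_le M t -> d i - e <= t.
Proof.
move=> t0 ht.
pose v : 'cV[C]_k := Vn *m delta_mx i 0.
have fd := fro2_delta i.
have fv : frob v = 1 by rewrite /frob -/(fro2 v) fro2_iso // fd sqrtr1.
have Zv : frob (Z *m v) = d i.
  rewrite /frob -/(fro2 _) /Z /v -!mulmxA (mulmxA (ctr Vn)) hVn mul1mx fro2_iso //.
  by rewrite real_diag_delta fro2Z fd mulr1 sqrtr_sqr ger0_norm // ltW.
have h1 := opnorm_le_frob v t0 ht; have h2 := opnorm_le_frob v e0 hM.
have h3 : frob (Z *m v) <= frob (M *m v) + frob ((M - Z) *m v).
  rewrite -[frob ((M - Z) *m v)]frobN.
  by apply: le_trans (frobD _ _); rewrite mulmxBl opprB addrC subrK.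
rewrite fv mulr1 Zv in h1 h2 h3; lra.
Qed.

(** The rotated true factor is feasible: its squared row norms are at most b (d i0), while the
    square of [specnorm Lt] is at least t i0 >= d i0 - e >= d i0 / 2. This is the purpose of the 2
    in c = 2 b. *)
Lemma factor_proj p (U Ut P : 'M[C]_(p, r)) (t : 'I_r -> R) (c : R) (Q : 'M[C]_r) :
  let Lt := Ut *m real_diag (fun i => Num.sqrt (t i)) in
  unitary_cols U -> unitary_cols Ut -> unitary_cols Q ->
  (forall i, fro2 (row i U) <= b) -> d i0 - e <= t i0 -> c = 2 * b ->
  is_proj (fun L => norm2inf L ^+ 2 <= c * specnorm Lt ^+ 2) Lt P ->
  fro2 (P - U *m real_diag sq *m Q) <= fro2 (Lt - U *m real_diag sq *m Q).
Proof.
move=> Lt hU hUt hQ hb ht ec hP.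
have /andP[hs0 _] := hd i0.
have e1 := es; have s1 := s0.
have t0 : 0 <= t i0 by lra.
apply: proj_nonexpansive hP _.
  by move=> X Y a; apply: norm2inf_convex.
have hspec : t i0 <= specnorm Lt ^+ 2.
  pose v : 'cV[C]_r := delta_mx i0 0.
  have fd : fro2 v = 1 := fro2_delta i0.
  have fv : frob v = 1 by rewrite /frob -/(fro2 v) fd sqrtr1.
  apply: le_trans (_ : frob (Lt *m v) ^+ 2 <= _); last first.
    have h := specnorm_ge Lt fv.
    by rewrite ler_pXn2r ?nnegrE ?frob_ge0 ?(le_trans (frob_ge0 _) h).
  rewrite frob_sqr /Lt -mulmxA fro2_iso //.
  by rewrite real_diag_delta fro2Z fd mulr1 sqr_sqrtr.
apply/norm2inf_le => [|i]; first by rewrite ec mulr_ge0 ?sqr_ge0 // mulr_ge0.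
rewrite row_mul -[Q]ctrK fro2_isor; last by rewrite /unitary_cols ctrK unitary_colsC.
have hsq j : 0 <= sq j <= sq i0.
  by rewrite sqrtr_ge0 ler_wsqrtr //; have /andP[] := hd j.
apply: le_trans (row_scaled_le hb hsq i) _.
rewrite sqr_sqrtr ?(ltW (d0 i0)) // ec.
apply: le_trans (_ : 2 * b * t i0 <= _); last by rewrite ler_wpM2l // mulr_ge0.
have := ler_wpM2r b0 (_ : d i0 <= 2 * t i0); rewrite mulrAC; apply; lra.
Qed.

Lemma spectral_init (U0 : 'M[C]_(m, r)) (S0 : 'M[C]_r) (V0 : 'M[C]_(k, r))
    (L0 : 'M[C]_(m, r)) (R0 : 'M[C]_(k, r)) (c : R) :
  is_trunc_svd M U0 S0 V0 -> c = 2 * b ->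
  let Lt := U0 *m sqrt_diag S0 in let Rt := V0 *m sqrt_diag S0 in
  is_proj (fun L => norm2inf L ^+ 2 <= c * specnorm Lt ^+ 2) Lt L0 ->
  is_proj (fun L => norm2inf L ^+ 2 <= c * specnorm Rt ^+ 2) Rt R0 ->
  dist0 L0 (Un *m real_diag sq) R0 (Vn *m real_diag sq) <= 5 * Num.sqrt r%:R * (e / Num.sqrt s).
Proof.
move=> hsvd ec Lt Rt hL hR.
have [hU0 hV0 hMr [t [t0 eS ht]]] := trunc_svdP hrm hrk hsvd (erefl Z) hM.
have ti0 := top_le i0 (t0 i0) (ht i0 hi0).
have eLt : Lt = U0 *m real_diag (fun i => Num.sqrt (t i)) by rewrite /Lt eS sqrt_real_diag.
have eRt : Rt = V0 *m real_diag (fun i => Num.sqrt (t i)) by rewrite /Rt eS sqrt_real_diag.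
have sqt : real_diag (fun i => Num.sqrt (t i)) *m real_diag (fun i => Num.sqrt (t i)) = real_diag t.
  by rewrite real_diagM; apply: eq_real_diag => i; rewrite -expr2 sqr_sqrtr.
have hMZ : opnorm_le (U0 *m S0 *m ctr V0 - Z) (e + e).
  have -> : U0 *m S0 *m ctr V0 - Z = - (M - U0 *m S0 *m ctr V0) + (M - Z).
    by rewrite opprB subrKA.
  by apply: opnorm_leD => //; apply: opnorm_leN.
have hF : fro2 (U0 *m S0 *m ctr V0 - Z) <= 2 * r%:R * (e + e) ^+ 2.
  by apply: lowrank_close hU0 hVn _ (erefl Z) hMZ; rewrite -mulmxA.
have [| |j v|Q hQ hd2] :=
    @factor_dist _ m k r Lt (Un *m real_diag sq) Rt (Vn *m real_diag sq) s.
- by rewrite eLt eRt !gram_factor.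
- by rewrite !gram_factor.
- rewrite -mulmxA fro2_iso // -[s]sqr_sqrtr ?(ltW s0) //; apply: real_diag_lb.
    exact: sqrtr_ge0.
  by move=> i; rewrite ler_wsqrtr //; have /andP[] := hd i.
have eZ : Un *m real_diag sq *m ctr (Vn *m real_diag sq) = Z.
  by rewrite ctrM ctr_real_diag !mulmxA -[Un *m _ *m _]mulmxA sq2.
have eMr : Lt *m ctr Rt = U0 *m S0 *m ctr V0.
  by rewrite eLt eRt ctrM ctr_real_diag !mulmxA -[U0 *m _ *m _]mulmxA sqt eS.
rewrite eZ eMr in hd2.
have hL' : fro2 (L0 - Un *m real_diag sq *m Q) <= fro2 (Lt - Un *m real_diag sq *m Q).
  by rewrite eLt in hL *; apply: factor_proj hL.
have hR' : fro2 (R0 - Vn *m real_diag sq *m Q) <= fro2 (Rt - Vn *m real_diag sq *m Q).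
  by rewrite eRt in hR *; apply: factor_proj hR.
apply: le_trans (_ : Num.sqrt (frob (L0 - Un *m real_diag sq *m Q) ^+ 2 +
                               frob (R0 - Vn *m real_diag sq *m Q) ^+ 2) <= _).
  apply: ge_inf; last by exists Q.
  by exists 0 => _ [Q' [_ ->]]; apply: sqrtr_ge0.
rewrite !frob_sqr.
have rhs0 : 0 <= 5 * Num.sqrt r%:R * (e / Num.sqrt s).
  by rewrite mulr_ge0 ?divr_ge0 ?sqrtr_ge0 // mulr_ge0 ?sqrtr_ge0.
rewrite -[leRHS]ger0_norm // -sqrtr_sqr ler_wsqrtr //.
rewrite !exprMn exprVn !sqr_sqrtr ?ler0n ?(ltW s0) //.
apply: le_trans (lerD hL' hR') _.
rewrite -(ler_pM2l s0); apply: le_trans hd2 _.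
(* The chain of bounds yields 3 times 2 r (2 e)^2, that is 24 r e^2, and 24 <= 5^2. *)
have -> : s * (5 ^+ 2 * r%:R * (e ^+ 2 / s)) = 25 * (r%:R * e ^+ 2).
  by field; rewrite gt_eqF.
have : 0 <= r%:R * e ^+ 2 by rewrite mulr_ge0 ?sqr_ge0.
lra.
Qed.

End Core.

End Initialization.

(** * The residual matrix and the final estimate *)

Section Assembly.
Variable R : realType.
Local Notation C := R[i].

Lemma vsig_gt0 n1 n2 (k : 'I_(n1 + n2).-1) : (0 < n1)%N -> (0 < n2)%N ->
  (0 < vsig k)%N.
Proof.
move=> h1 h2; have [i [j hk]] := hidx_surj k h1 h2.
by apply/card_gt0P; exists (i, j); rewrite inE /= hk.
Qed.

(** [Num.sqrt] is 0 on nonpositive numbers, so b <= 0 would force U = 0, against the squared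
    Frobenius norm r > 0. *)
Lemma incoherent_rows m r (U : 'M[C]_(m, r)) (b : R) : (0 < r)%N ->
  unitary_cols U -> norm2inf U <= Num.sqrt b ->
  0 < b /\ forall i, fro2 (row i U) <= b.
Proof.
move=> r0 hU hb.
have h i : fro2 (row i U) <= Num.sqrt b ^+ 2.
  move: i; apply/norm2inf_le; first exact: sqr_ge0.
  by rewrite ler_pXn2r ?nnegrE ?sqrtr_ge0 ?norm2inf_ge0.
have b0 : 0 < b.
  rewrite ltNge; apply/negP => bn; have := fro2_unitary hU.
  rewrite fro2_row => e.
  have : (r%:R : R) <= 0.
    rewrite -e; apply: sumr_le0 => i _; apply: le_trans (h i) _.
    by rewrite ler0_sqrtr // expr0n.
  by rewrite lern0 => /eqP r00; rewrite r00 in r0.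
by split => // i; rewrite -[b]sqr_sqrtr ?h // ltW.
Qed.

(** Every antidiagonal is nonempty, so the weights in [Dop] are invertible and cancel against those
    in [Gop]. *)
Lemma init_residual n1 n2 (x v w : 'I_(n1 + n2).-1 -> C) (p : R)
    (O : {set 'I_(n1 + n2).-1}) : (0 < n1)%N -> (0 < n2)%N ->
  (p^-1)%:C *: Gop n1 n2 (fun k => PiO O (fun k => Dop n1 n2 x k + v k) k
                                   - Dop n1 n2 w k) - hankel n1 n2 x
  = hankel n1 n2 (fun k => (noise p O k)%:C * x k
                           + (p^-1)%:C * (Dinv n1 n2 (PiO O v) k - w k)).
Proof.
move=> h1 h2; apply/matrixP => i j; rewrite !mxE; set k := hidx i j.
rewrite /Dinv /Dop /PiO /noise.
set c := (Num.sqrt _)%:C.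
have c0 : c != 0.
  rewrite /c (inj_eq (@complexI R) _ 0) sqrtr_eq0 -ltNge ltr0n.
  exact: vsig_gt0.
have -> : ((k \in O)%:R / p - 1)%:C = (k \in O)%:R * (p^-1)%:C - 1 :> C.
  by rewrite rmorphB rmorphM rmorph_nat rmorph1.
by move: (p^-1)%:C => u; case: (k \in O) => /=; field; exact: c0.
Qed.

Lemma residual_opnorm_le n1 n2 (x t w : 'I_(n1 + n2).-1 -> C) (z : C) (p a1 a2 : R)
    (O : {set 'I_(n1 + n2).-1}) : (0 < n1)%N -> (0 < n2)%N -> 0 < p ->
  ((n1 + n2).-1).-primitive_root z ->
  (forall l : 'I_(n1 + n2).-1,
     cabs (\sum_k ((noise p O k)%:C * x k) * z ^+ (l * k)) <= a1) ->
  \sum_k cabs (t k - w k) <= p * a2 ->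
  opnorm_le (hankel n1 n2 (fun k => (noise p O k)%:C * x k + (p^-1)%:C * (t k - w k)))
    (a1 + a2).
Proof.
move=> h1 h2 p0 hz ha1 ha2; apply: (opnorm_le_hankel h1 h2 hz) => l.
under eq_bigr => k _ do rewrite mulrDl.
rewrite big_split /=; apply: le_trans (cabsD _ _) _; apply: lerD (ha1 l) _.
apply: le_trans (cabs_sum _ _ _) _.
rewrite (eq_bigr (fun k => p^-1 * cabs (t k - w k))) => [|k _].
  by rewrite -mulr_sumr mulrC ler_pdivrMr // mulrC.
have cz : cabs (z ^+ (l * k)) = 1.
  have z1 := prim_root_cabs2 hz.
  elim: (l * k)%N => [|j IH]; first by rewrite expr0 (cabs_real 1) normr1.
  by rewrite exprS cabsM IH mulr1 /cabs z1 sqrtr1.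
by rewrite !cabsM cz mulr1 cabs_real ger0_norm // invr_ge0 ltW.
Qed.

End Assembly.

Theorem theorem2 (R : realType) :
  exists c0 : R, 0 < c0 /\
  forall (n1 n2 r : nat) (xn sn : 'I_(n1 + n2).-1 -> R[i])
    (Un : 'M[R[i]]_(n1, r)) (sig : nat -> R) (Vn : 'M[R[i]]_(n2, r))
    (mu p alpha eps0 : R),
  let n := (n1 + n2).-1 in
  let cs := Num.max (n%:R / n1%:R) (n%:R / n2%:R) in
  let kappa := sig 0%N / sig r.-1 in
  (0 < n1)%N -> (0 < n2)%N -> (0 < r)%N ->
  (* rank-r Hankel matrix with compact SVD  H x = U Sigma V^* *)
  \rank (hankel n1 n2 xn) = r ->
  unitary_cols Un -> unitary_cols Vn ->
  (forall k, (k < r)%N -> 0 < sig k) ->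
  (forall k l, (k <= l < r)%N -> sig l <= sig k) ->
  hankel n1 n2 xn = Un *m rdiag r sig *m ctr Vn ->
  (* mu-incoherence *)
  norm2inf Un <= Num.sqrt (mu * cs * r%:R / n%:R) ->
  norm2inf Vn <= Num.sqrt (mu * cs * r%:R / n%:R) ->
  (* Bernoulli sampling rate and parameter conditions *)
  0 <= p <= 1 ->
  0 < eps0 < Num.sqrt (kappa * r%:R) / (8 * c0) ->
  (eps0 ^-2 * kappa ^+ 3 * cs * mu * r%:R ^+ 2 * ln n%:R) / n%:R <= p ->
  0 <= alpha -> alpha <= 1 / (32 * cs * mu * r%:R * kappa) ->
  let f := fun k => Dop n1 n2 xn k + sn k in
  let Ln := Un *m rdiag r (fun k => Num.sqrt (sig k)) in
  let Rn := Vn *m rdiag r (fun k => Num.sqrt (sig k)) in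
  exists E : {set {set 'I_n}},
    1 - 2 / n%:R ^+ 2 <= bern_prob p E /\
    forall O : {set 'I_n}, O \in E ->
      (* observed outliers are alpha p-sparse *)
      (l0 (PiO O sn))%:R <= alpha * p * n%:R ->
      (* every possible output of the HSGD initialization step *)
      forall w : 'I_n -> R[i],
        is_Gamma (Num.truncn (alpha * p * n%:R)) (Dinv n1 n2 (PiO O f)) w ->
      let s0 := Dop n1 n2 w in
      forall (U0 : 'M[R[i]]_(n1, r)) (S0 : 'M[R[i]]_r) (V0 : 'M[R[i]]_(n2, r)),
        is_trunc_svd ((p^-1)%:C *: Gop n1 n2 (fun k => PiO O f k - s0 k)) U0 S0 V0 ->
      let Lt := U0 *m sqrt_diag S0 in
      let Rt := V0 *m sqrt_diag S0 in
      forall (L0 : 'M[R[i]]_(n1, r)) (R0 : 'M[R[i]]_(n2, r)),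
        is_proj (fun L => norm2inf L ^+ 2
                   <= 2 * mu * r%:R * cs / n%:R * specnorm Lt ^+ 2) Lt L0 ->
        is_proj (fun L => norm2inf L ^+ 2
                   <= 2 * mu * r%:R * cs / n%:R * specnorm Rt ^+ 2) Rt R0 ->
        dist0 L0 Ln R0 Rn
          <= 26 * alpha * cs * kappa * mu * r%:R * Num.sqrt r%:R * Num.sqrt (sig r.-1)
             + 7 * c0 * eps0 * Num.sqrt (sig r.-1 / kappa).
Proof.
(* With this constant the range of [eps0] gives q <= 1/800 below, small enough for e <= s / 4; and 7
   c0 = 700 exceeds the 80 produced at the end. *)
exists 100; split; first by [].
move=> n1 n2 r xn sn Un sig Vn mu p alpha eps0 n cs kappa n1p n2p rp hrank hUn hVn.
move=> sig0 sigm hZ incU incV /andP[p0 p1] /andP[eps_gt0 eps_lt] hp alpha0 halpha.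
move=> f Ln Rn.
(* For n = 1 the required probability is -1 and the empty event serves; for n > 1 the logarithm is
   positive. *)
have [n_le1|n_gt1] := leqP n 1.
  exists finset.set0; split; last by move=> O; rewrite inE.
  have -> : n = 1%N by move: n_le1; rewrite /n; lia.
  by rewrite /bern_prob big_set0; lra.
set b := mu * cs * r%:R / n%:R in incU incV.
have [b0 hbU] := incoherent_rows rp hUn incU.
have [_ hbV] := incoherent_rows rp hVn incV.
pose d (i : 'I_r) := sig i; pose i0 := Ordinal rp; pose s := sig r.-1.
have rp' : (r.-1 < r)%N by rewrite ltn_predL.
have s0 : 0 < s := sig0 _ rp'.
have hd i : s <= d i <= d i0.
  apply/andP; split.
    by apply: sigm; rewrite rp' andbT -ltnS prednK.
  by apply: sigm; rewrite leq0n ltn_ord.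
have s1 : s <= sig 0%N by have /andP[] := hd i0.
have kappa1 : 1 <= kappa by rewrite /kappa ler_pdivlMr ?mul1r.
have ks : kappa * s = sig 0%N by rewrite /kappa divfK // gt_eqF.
clearbody kappa.
have hd' i : 0 <= d i <= sig 0%N.
  by have /andP[h ->] := hd i; rewrite andbT (le_trans (ltW s0)).
have rn1 : (r <= n1)%N by rewrite -hrank rank_leq_row.
have rn2 : (r <= n2)%N by rewrite -hrank rank_leq_col.
rewrite rdiagE in hZ.
have hZt : ctr (hankel n1 n2 xn) = Vn *m real_diag d *m ctr Un.
  by rewrite hZ !ctrM ctrK ctr_real_diag mulmxA.
have hx k : cabs (xn k) <= sig 0%N * b.
  have [i [j <-]] := hidx_surj k n1p n2p.
  have := entry_lowrank_le hbU hd' i j hbV; rewrite -hZ mxE -cabs_sqr.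
  by rewrite ler_pXn2r ?nnegrE ?cabs_ge0 // mulr_ge0 ?(ltW b0) // ltW // sig0.
have hx2 : \sum_k cabs2 (xn k) <= 2 * (sig 0%N ^+ 2 * b).
  apply: (sum_hankel_le n1p n2p) => i.
    by rewrite hZ; apply: row_lowrank_le.
  by rewrite hZt; apply: row_lowrank_le.
have nn : (0 : R) < n%:R by rewrite ltr0n ltnW.
have L0 : (0 : R) < ln n%:R by rewrite ln_gt0 // ltr1n.
have rR : (0 : R) < r%:R by rewrite ltr0n.
have k0 : 0 < kappa by apply: lt_le_trans kappa1.
have nb : n%:R * b = mu * cs * r%:R by rewrite /b mulrC divfK // gt_eqF.
have lowp : eps0 ^- 2 * kappa ^+ 3 * cs * mu * r%:R ^+ 2 * ln n%:R / n%:R =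
    kappa ^+ 3 * r%:R * (b * ln n%:R) / eps0 ^+ 2.
  by rewrite /b; field; rewrite !gt_eqF.
rewrite lowp in hp.
have ec : 2 * mu * r%:R * cs / n%:R = 2 * b by rewrite /b; ring.
clearbody b.
have pp : 0 < p.
  apply: lt_le_trans hp; rewrite divr_gt0 ?exprn_gt0 //.
  by apply: mulr_gt0; apply: mulr_gt0; rewrite ?exprn_gt0.
(* [g] is the noise level relative to the top singular value: on the good event the Fourier
   coefficients of the noise are at most 16 g (sig 0). *)
have [g eg] : exists g, g = Num.sqrt (b * ln n%:R / p) by eexists.
have blp : 0 < b * ln n%:R / p := divr_gt0 (mulr_gt0 b0 L0) pp.
have g0 : 0 < g by rewrite eg sqrtr_gt0.
have g2 : g ^+ 2 = b * ln n%:R / p by rewrite eg sqr_sqrtr // ltW.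
have kr0 : 0 < kappa * r%:R := mulr_gt0 k0 rR.
(* In terms of [q] the sampling rate reads kappa g <= q, and the target eps0 sqrt (s / kappa) is q
   sqrt r sqrt s. *)
have [q eq] : exists q, q = eps0 / Num.sqrt (kappa * r%:R) by eexists.
have q0 : 0 < q by rewrite eq divr_gt0 ?sqrtr_gt0.
have q1 : q <= 1 / 800.
  rewrite eq ler_pdivrMr ?sqrtr_gt0 //; apply: le_trans (ltW eps_lt) _.
  lra.
have q2 : q ^+ 2 = eps0 ^+ 2 / (kappa * r%:R).
  by rewrite eq exprMn exprVn sqr_sqrtr // ltW.
have gq : kappa * g <= q.
  rewrite -(@ler_pXn2r _ 2) ?nnegrE ?mulr_ge0 ?(ltW g0) ?(ltW q0) ?(ltW k0) //.
  rewrite exprMn g2 q2 ler_pdivlMr //.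
  have -> : kappa ^+ 2 * (b * ln n%:R / p) * (kappa * r%:R) =
      kappa ^+ 3 * r%:R * (b * ln n%:R) / p by field; rewrite gt_eqF.
  by rewrite ler_pdivrMr // [leRHS]mulrC -ler_pdivrMr ?exprn_gt0.
have g1 : g <= 1 / 2.
  apply: le_trans (_ : kappa * g <= _); last by apply: le_trans gq _; lra.
  by rewrite -[leLHS]mul1r ler_wpM2r // ltW.
have [z hz] := complex_prim_root R (ltnW n_gt1).
have sg0 : 0 < sig 0%N by apply: lt_le_trans s1.
have [E [hE hEO]] := noise_dft_event n_gt1 pp p1 b0 sg0 hx hx2
  (prim_root_cabs2 hz) g0 g1 g2.
(* The event only constrains the Fourier transform of the noise; from here on the argument is
   deterministic. *)
exists E; split => // O /hEO hO hl0 w hw s0' U0 S0 V0 hsvd Lt Rt M0 N0 hM0 hN0.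
pose t := Dinv n1 n2 (PiO O sn).
have vs k : (Num.sqrt (@vsig n1 n2 k)%:R)%:C != 0 :> R[i].
  rewrite (inj_eq (@complexI R) _ 0) sqrtr_eq0 -ltNge ltr0n.
  exact: vsig_gt0.
have apn0 : 0 <= alpha * p * n%:R by rewrite !mulr_ge0 // ltW.
pose K := Num.truncn (alpha * p * n%:R).
have hK : K%:R <= alpha * p * n%:R by rewrite truncn_le.
(* The sparsity bound is a real number; [l0] being an integer, the bound passes to its
   truncation. *)
have tK : (l0 t <= K)%N.
  rewrite truncn_ge_nat //; apply: le_trans hl0; rewrite ler_nat.
  apply: subset_leq_card; apply/fintype.subsetP => k; rewrite !inE.
  by apply: contra => /eqP e; rewrite /t /Dinv e mul0r.
have hsp : \sum_k cabs (t k - w k) <= p * (3 * alpha * n%:R * (sig 0%N * b)).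
  have X0 : 0 <= sig 0%N * b by rewrite mulr_ge0 // ltW.
  have hxO k : cabs (PiO O xn k) <= sig 0%N * b.
    by rewrite /PiO; case: ifP => // _; rewrite cabs0.
  have hy k : Dinv n1 n2 (PiO O f) k = PiO O xn k + t k.
    rewrite /t /Dinv /f /PiO /Dop; case: ifP => _; last by rewrite !mul0r addr0.
    by field; exact: vs.
  apply: le_trans (threshold_error X0 hxO hy tK hw) _.
  have -> : p * (3 * alpha * n%:R * (sig 0%N * b)) =
    3 * (alpha * p * n%:R) * (sig 0%N * b) by ring.
  by apply: ler_wpM2r => //; apply: ler_wpM2l.
have hres := residual_opnorm_le n1p n2p pp hz hO hsp.
rewrite -init_residual // -/s0' in hres.
(* Since n b = mu cs r, the outlier part of the residual is at most 3 a s, and the hypothesis on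
   [alpha] becomes a <= 1/32. *)
pose a := alpha * cs * mu * r%:R * kappa.
have den0 : 0 < cs * mu * r%:R by rewrite (mulrC cs) -nb mulr_gt0.
have a0 : 0 <= a.
  by rewrite /a -!mulrA mulr_ge0 // !mulrA mulr_ge0 ?(ltW k0) // ltW.
have a1 : a <= 1 / 32.
  move: halpha; rewrite ler_pdivlMr; last first.
    by rewrite -!mulrA mulr_gt0 // !mulrA mulr_gt0.
  rewrite /a; lra.
have ee : 16 * (sig 0%N * g) + 3 * alpha * n%:R * (sig 0%N * b) =
    16 * (s * (kappa * g)) + 3 * (a * s).
  rewrite -ks /a (_ : 3 * alpha * n%:R * (kappa * s * b) = 3 * alpha * (kappa * s) * (n%:R * b)).
    rewrite nb; ring.
  ring.
rewrite ee in hres; set e := 16 * _ + _ in hres.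
have e_le : e <= s * (16 * q + 3 * a).
  by have := ler_wpM2l (ltW s0) gq; rewrite /e; lra.
have e0 : 0 <= e.
  have h1 := mulr_ge0 (ltW s0) (mulr_ge0 (ltW k0) (ltW g0)).
  have h2 := mulr_ge0 a0 (ltW s0); rewrite /e; lra.
(* 16/800 + 3/32 < 1/4. *)
have es : e <= s / 4.
  apply: le_trans e_le _; rewrite ler_wpM2l ?(ltW s0) //; lra.
rewrite hZ in hres.
have hfin := spectral_init (i0 := i0) erefl rn1 rn2 hUn hVn hbU hbV (ltW b0) s0 hd
  e0 es hres hsvd ec hM0 hN0.
rewrite /Ln /Rn !rdiagE; apply: le_trans hfin _.
have ss0 : 0 < Num.sqrt s by rewrite sqrtr_gt0.
have h1 : e / Num.sqrt s <= Num.sqrt s * (16 * q + 3 * a).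
  by rewrite ler_pdivrMr // mulrAC -expr2 sqr_sqrtr // ltW.
have h2 : eps0 * Num.sqrt (s / kappa) = q * (Num.sqrt r%:R * Num.sqrt s).
  rewrite eq sqrtrM ?(ltW s0) // sqrtrV ?(ltW k0) // sqrtrM ?(ltW k0) //.
  by field; rewrite !gt_eqF ?sqrtr_gt0.
have h3 : 0 <= Num.sqrt r%:R * Num.sqrt s :> R by rewrite mulr_ge0 ?sqrtr_ge0.
apply: le_trans (_ : 5 * Num.sqrt r%:R * (Num.sqrt s * (16 * q + 3 * a)) <= _).
  by rewrite ler_wpM2l // mulr_ge0 ?sqrtr_ge0.
have -> : 26 * alpha * cs * kappa * mu * r%:R * Num.sqrt r%:R * Num.sqrt s
    + 7 * 100 * eps0 * Num.sqrt (s / kappa)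
  = 26 * a * (Num.sqrt r%:R * Num.sqrt s) + 700 * (eps0 * Num.sqrt (s / kappa)).
  rewrite /a; ring.
(* The coefficients to compare are 5 * 16 = 80 against 700 for [q], and 5 * 3 = 15 against 26 for
   [a]. *)
rewrite h2; have := mulr_ge0 a0 h3; have := mulr_ge0 (ltW q0) h3; lra.
Qed.
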